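(* Suppose $\mu\neq0$ and $\varepsilon$ are two real numbers with $\varepsilon \le \frac{\mu^{2}}{4}$. Let $b=\frac{\mu - \sqrt{\mu^2 - 4\varepsilon}}{2}$. Let $f\in\bar{\mathcal{E}}_\mu(\mathbb{R}_+)$. Then equality holds in the inequality $$ \left(\int_{0}^{+\infty} (f'')^2 x^{\mu+1} dx\right) \left( \int_{0}^{+\infty} \left( x^2 (f')^2 - \varepsilon f^2 \right) x^{\mu-1} dx\right) \ge \frac{1}{4}\left(\sqrt{\mu^{2}-4\varepsilon}+1\right)^{2}\left( \int_{0}^{+\infty} (f')^2 x^{\mu} dx \right)^2 $$ if and only if for some $C\in\mathbb{R}$ and $\lambda>0$, $$f(x) = Ce^{-\lambda x} \, {}_1F_1(b, \mu, \lambda x)$$ in the case $\mu>0$, or $$f(x) = C(\lambda x)^{1-\mu}e^{-\lambda x} \, {}_1F_1(b+1-\mu, 2-\mu, \lambda x)$$ in the case $\mu < 0$.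
   Context: Let $\mathbb{R}_+=(0,+\infty)$ and $\mu\in\mathbb{R}$. For a twice differentiable real-valued function $f$ on $\mathbb{R}_+$, set $$ \|f\| := \left( \int_{0}^{+\infty} \left(x^{\mu+1}(f'')^2 +(x^{\mu+1}+x^{\mu-1})(f')^2+x^{\mu-1}f^{2}\right) dx \right)^{1/2}. $$ Let $\mathcal{E}_\mu(\mathbb{R}_+):= \{ f \in C^{\infty}(\mathbb{R}_+) : \|f\| < +\infty \}$ (real-valued functions), and let $\bar{\mathcal{E}}_\mu(\mathbb{R}_+)$ be the Hilbert space completion of $\mathcal{E}_\mu(\mathbb{R}_+)$ with respect to $\|\cdot\|$. Elements of $\bar{\mathcal{E}}_\mu(\mathbb{R}_+)$ are regarded in the usual way as (continuously differentiable representatives of) real-valued functions on $\mathbb{R}_+$, with $f''$ understood as a weak derivative. Here $${}_1F_1(b, \mu, x):=1+\sum_{k=1}^{+\infty}\frac{b(b+1)\cdots (b+k-1)}{\mu(\mu+1)\cdots (\mu+k-1)}\frac{x^k}{k!}$$ denotes Kummer's confluent hypergeometric function, which solves Kummer's ODE $xw''+(\mu-x)w'-bw=0$. *)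

(* Defs.v *)
From mathcomp Require Import all_boot all_order all_algebra.
From mathcomp Require Import all_classical all_reals all_analysis.
Set Implicit Arguments.
Unset Strict Implicit.
Unset Printing Implicit Defensive.
Import Order.TTheory GRing.Theory Num.Theory.
Import numFieldNormedType.Exports.
Local Open Scope classical_set_scope.
Local Open Scope ring_scope.

(* Functions on (0, +oo) are represented by total functions R -> R; only
   their values on (0, +oo) matter. *)

Definition Rpos {R : realType} : set R := `]0, +oo[%classic.

Definition kummer {R : realType} (b mu x : R) : R :=
  1 + limn (fun n => \sum_(1 <= k < n)
        ((\prod_(0 <= i < k) (b + i%:R)) / (\prod_(0 <= i < k) (mu + i%:R))
         * (x ^+ k / k`!%:R))).

(* The norm || f ||, where the second derivative of f is passed separately as
   f2, because it may exist only in the weak sense. *)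
Definition Enorm {R : realType} (mu : R) (f f2 : R -> R) : \bar R :=
  sqrte (\int[lebesgue_measure]_(x in Rpos)
    (x `^ (mu + 1) * f2 x ^+ 2
     + (x `^ (mu + 1) + x `^ (mu - 1)) * f^`()%classic x ^+ 2
     + x `^ (mu - 1) * f x ^+ 2)%:E)%E.

Definition smooth_on {R : realType} (D : set R) (f : R -> R) : Prop :=
  forall n x, D x -> derivable (f^`(n)%classic) x 1.

Definition Espace {R : realType} (mu : R) : set (R -> R) :=
  [set f | smooth_on Rpos f /\ (Enorm mu f f^`(2)%classic < +oo)%E].

Definition test_function {R : realType} (phi : R -> R) : Prop :=
  smooth_on setT phi /\
  exists a c : R, 0 < a /\ (forall x, phi x != 0 -> a <= x <= c).

Definition weak_derivative {R : realType} (h g : R -> R) : Prop :=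
  [/\ locally_integrable Rpos h, locally_integrable Rpos g &
      forall phi : R -> R, test_function phi ->
        \int[lebesgue_measure]_(x in Rpos) (h x * phi^`()%classic x)
        = - \int[lebesgue_measure]_(x in Rpos) (g x * phi x)].

Definition C1_on {R : realType} (D : set R) (f : R -> R) : Prop :=
  forall x, D x -> derivable f x 1 /\ {for x, continuous f^`()%classic}.

(* f is the continuously differentiable representative of an element of the
   completion of Espace mu, and f2 is its weak second derivative. Convergence
   in the norm controls f, f' and f'' in weighted L^2 spaces, so every Cauchy
   sequence of Espace mu converges to exactly one such f (and to one f2 up to
   a null set): the functions f satisfying this predicate are the elements of
   the completion. *)
Definition Ecompletion {R : realType} (mu : R) (f f2 : R -> R) : Prop :=
  [/\ C1_on Rpos f,
      weak_derivative f^`()%classic f2 &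
      exists u : (R -> R)^nat,
        (forall n, Espace mu (u n)) /\
        (fun n => Enorm mu (f \- u n) (f2 \- (u n)^`(2)%classic)) @ \oo --> 0%E].

(* Main.v *)
Require Import Defs.
From mathcomp Require Import all_boot all_order all_algebra.
From mathcomp Require Import all_classical all_reals all_analysis.
From mathcomp Require Import measurable_realfun ring lra.
Import Order.TTheory GRing.Theory Num.Theory.
Import numFieldNormedType.Exports.
Local Open Scope classical_set_scope.
Local Open Scope ring_scope.
Set Implicit Arguments.
Unset Strict Implicit.

(* Put s = sqrt (mu^2 - 4 eps), c = (mu + s) / 2, so that eps = c (mu - c) and
   b = mu - c, and let A, B, D be the three integrals of the inequality. With
   L u = x u'' + (l x + mu) u' + l c u, the function
     x^(mu-1) (L u)^2 - [x^(mu+1) u''^2 + l^2 (x^2 u'^2 - eps u^2) x^(mu-1)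
                         - l (s + 1) x^mu u'^2]
   is the derivative of some T with T / x integrable. Since 1 / x is integrable
   neither at 0 nor at +oo, T tends to 0 along sequences going to 0 and to +oo,
   so that A + l^2 B - l (s + 1) D is the integral of x^(mu-1) (L u)^2, first
   for smooth u, then on the completion by continuity of quadratic forms. This
   quadratic polynomial in l is nonnegative, and equality in the theorem means
   that its discriminant vanishes, i.e. (unless f = 0) that L f = 0 for some
   l > 0. This equation is Kummer's equation for f(x) = exp (- l x) w(l x), and
   a Wronskian argument shows that finite energy near 0 selects one solution up
   to a constant factor. *)

(** * Integration on (0, +oo) *)

Local Notation leb := (@lebesgue_measure _).
Local Notation integrable_on D F := ((@lebesgue_measure _).-integrable D (EFin \o F)).

(** The number c is the larger root of c^2 - mu c + eps = 0. With it the cross terms in the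
    expansion of (L u)^2 are a total derivative, the coefficient of u^2 is eps, and that of D is s +
    1; the smaller root would give 1 - s, hence another constant. Two obstacles shape the proof.
    Finite energy gives no limits at 0 and +oo beforehand, so boundary terms are removed only along
    sequences. And f'' is a weak derivative, known almost everywhere: approximation in energy shows
    that f' is a primitive of it; once L f = 0 almost everywhere, f'' agrees almost everywhere with
    a continuous expression in f and f', so that f is of class C^2 and classical arguments on the
    equation apply. When D = 0, f is constant, hence zero, because x^(mu-1) is not integrable on (0,
    +oo). When mu < 0, writing u = x^(1-mu) w turns the equation with parameters mu, c into the one
    with parameters 2 - mu, 1 - mu + c, and 2 - mu > 0. *)

Lemma RposE {R : realType} (x : R) : Rpos x = (0 < x) :> Prop.
Proof. by rewrite /Rpos /= in_itv /= andbT. Qed.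

Lemma mem_Rpos {R : realType} (x : R) : (x \in Rpos) = (0 < x).
Proof. by apply/idP/idP; rewrite inE RposE. Qed.

Lemma open_Rpos {R : realType} : open (@Rpos R).
Proof. exact: interval_open. Qed.

Lemma measurable_Rpos {R : realType} : measurable (@Rpos R).
Proof. exact: measurable_itv. Qed.

#[local] Hint Resolve open_Rpos measurable_Rpos : core.

Lemma segment_Rpos {R : realType} (a b : R) : 0 < a -> `[a, b] `<=` Rpos.
Proof.
move=> a0 x /=; rewrite RposE in_itv /= => /andP[ax _].
exact: lt_le_trans ax.
Qed.

Lemma is_derive_continuous {R : realType} (F : R -> R) (x df : R) :
  is_derive x 1 F df -> {for x, continuous F}.
Proof. by move=> dF; apply/differentiable_continuous/derivable1_diffP/ex_derive. Qed.

Lemma measurable_Rpos_continuous {R : realType} (F : R -> R) :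
  (forall x : R, 0 < x -> {for x, continuous F}) -> measurable_fun Rpos F.
Proof.
move=> cF; apply: measurable_realfun.open_continuous_measurable_fun => //.
by move=> x; rewrite mem_Rpos; exact: cF.
Qed.

Lemma continuous_Rpos_segment {R : realType} (F : R -> R) (a b : R) :
  0 < a -> (forall x : R, 0 < x -> {for x, continuous F}) ->
  {within `[a, b], continuous F}.
Proof.
move=> a0 cF; apply: continuous_in_subspaceT => x; rewrite inE => xab.
by apply: cF; rewrite -RposE; exact: segment_Rpos a0 _ xab.
Qed.

Lemma integrable_segment {R : realType} (F : R -> R) (a b : R) :
  0 < a -> (forall x : R, 0 < x -> {for x, continuous F}) ->
  integrable_on `[a, b] F.
Proof.
move=> a0 cF; apply: continuous_compact_integrable.
  exact: segment_compact.
exact: continuous_Rpos_segment.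
Qed.

Lemma Rintegral_FTC {R : realType} (F f : R -> R) (a b : R) : 0 < a -> a < b ->
  (forall x : R, 0 < x -> is_derive x 1 F (f x)) ->
  (forall x : R, 0 < x -> {for x, continuous f}) ->
  \int[leb]_(x in `[a, b]) f x = F b - F a.
Proof.
move=> a0 ab dF cf; rewrite /Rintegral (@continuous_FTC2 _ f F)//.
- exact: continuous_Rpos_segment.
- have cF (x : R) : 0 < x -> {for x, continuous F}.
    by move=> x0; apply: is_derive_continuous (dF x x0).
  split.
  + move=> x; rewrite in_itv /= => /andP[ax _].
    exact: (@ex_derive _ _ _ _ _ _ _ (dF x (lt_trans a0 ax))).
  + by apply: cvg_at_right_filter; exact: cF.
  + by apply: cvg_at_left_filter; exact: cF (lt_trans a0 ab).
- move=> x; rewrite in_itv /= => /andP[ax _].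
  by rewrite derive1E; have [_ ->] := dF x (lt_trans a0 ax).
Qed.

Lemma integrable_le {R : realType} (D : set R) (F G : R -> R) :
  measurable D -> measurable_fun D F -> integrable_on D G ->
  (forall x, D x -> `|F x| <= G x) -> integrable_on D F.
Proof.
move=> mD mF iG FG; apply: le_integrable iG => //.
  exact/measurable_EFinP.
move=> x Dx /=; rewrite lee_fin (le_trans (FG x Dx))//; exact: ler_norm.
Qed.

Lemma integrable_norm {R : realType} (D : set R) (F : R -> R) :
  measurable D -> integrable_on D F -> integrable_on D (fun x => `|F x|).
Proof. by move=> mD /(integrable_abse) iF; exact: iF. Qed.

Lemma integrable_onS {R : realType} (A B : set R) (F : R -> R) :
  measurable A -> measurable B -> A `<=` B -> integrable_on B F ->
  integrable_on A F.
Proof. by move=> mA mB AB iF; apply: integrableS iF. Qed.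

Lemma integrable_on_segment {R : realType} (a b : R) (F : R -> R) :
  0 < a -> integrable_on Rpos F -> integrable_on `[a, b] F.
Proof.
move=> a0; apply: integrable_onS => //; exact: segment_Rpos.
Qed.

Lemma le_Rintegral_norm_subset {R : realType} (A B : set R) (F : R -> R) :
  measurable A -> measurable B -> A `<=` B -> integrable_on B F ->
  \int[leb]_(x in A) `|F x| <= \int[leb]_(x in B) `|F x|.
Proof.
move=> mA mB AB iF; have iB := integrable_norm mB iF.
have iA : integrable_on A (fun x => `|F x|) by apply: integrableS iB.
rewrite /Rintegral fine_le ?integrable_fin_num//.
apply: ge0_subset_integral => //=; exact: measurable_int iB.
Qed.

(* Quantifies the non-integrability of [1 / x] at [0] and at [+oo]. *)
Lemma ln_ratio_le_Rintegral {R : realType} (F : R -> R) (a b e : R) :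
  integrable_on Rpos F -> 0 < a -> a < b -> 0 <= e ->
  (forall x, a <= x -> x <= b -> e <= x * `|F x|) ->
  e * (ln b - ln a) <= \int[leb]_(x in Rpos) `|F x|.
Proof.
move=> iF a0 ab e0 eF.
have sub := @segment_Rpos R a b a0.
have mab : measurable (`[a, b] : set R) by exact: measurable_itv.
have iab : integrable_on `[a, b] F by exact: integrable_on_segment.
apply: le_trans (le_Rintegral_norm_subset mab measurable_Rpos sub iF).
have ci (x : R) : 0 < x -> {for x, continuous (fun y : R => e * y^-1)}.
  move=> x0; apply: cvgM; first exact: cvg_cst.
  by apply: cvgV; [rewrite gt_eqF|exact: cvg_id].
have -> : e * (ln b - ln a) = \int[leb]_(x in `[a, b]) (e * x^-1).
  have dF (x : R) : 0 < x -> is_derive x 1 (fun x => e * ln x) (e * x^-1).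
    by move=> x0; exact: (@is_deriveZ R R R _ e x 1 _ (is_derive1_ln x0)).
  by rewrite mulrBr (Rintegral_FTC a0 ab dF ci).
apply: le_Rintegral => //; first exact: integrable_segment.
    by apply: (@integrable_norm _ _ F) => //.
  move=> x /= xab; have x0 : 0 < x by rewrite -RposE; exact: sub.
  move: xab; rewrite in_itv /= => /andP[ax xb].
  by rewrite ler_pdivrMr// mulrC eF.
Qed.

(** Otherwise [|F|] is at least [e / x] on (0, d), whose integral diverges logarithmically. *)
Lemma integrable_small_left {R : realType} (F : R -> R) (d e : R) :
  integrable_on Rpos F -> 0 < d -> 0 < e ->
  exists2 x, 0 < x < d & x * `|F x| < e.
Proof.
move=> iF d0 e0; apply: contrapT => H.
set I := \int[leb]_(x in Rpos) `|F x|.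
have I0 : 0 <= I by apply: Rintegral_ge0.
(* [a] is chosen so that [e * (ln b - ln a)] is exactly [I + 1], more than the whole integral. *)
pose b := d / 2; pose a := b * expR (- ((I + 1) / e)).
have b0 : 0 < b by rewrite divr_gt0.
have a0 : 0 < a by rewrite mulr_gt0 ?expR_gt0.
have ab : a < b.
  by rewrite /a gtr_pMr// expR_lt1 oppr_lt0 divr_gt0// ltr_wpDl.
have := @ln_ratio_le_Rintegral R F a b e iF a0 ab (ltW e0).
have -> : ln b - ln a = (I + 1) / e.
  by rewrite /a lnM ?posrE ?expR_gt0// expRK; ring.
rewrite mulrCA divff ?gt_eqF// mulr1 => H1; suff : I + 1 <= I.
  by rewrite -[X in _ <= X]addr0 lerD2l ler10.
apply: H1.
  move=> x ax xb; rewrite leNgt; apply/negP => xF; apply: H; exists x => //.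
  rewrite (lt_le_trans a0 ax)/= (le_lt_trans xb)// /b.
  by rewrite ltr_pdivrMr// mulr_natr mulr2n ltrDl.
Qed.

Lemma integrable_small_right {R : realType} (F : R -> R) (M e : R) :
  integrable_on Rpos F -> 0 < e -> exists2 x, M < x & x * `|F x| < e.
Proof.
move=> iF e0; apply: contrapT => H.
set I := \int[leb]_(x in Rpos) `|F x|.
have I0 : 0 <= I by apply: Rintegral_ge0.
pose a := `|M| + 1; pose b := a * expR ((I + 1) / e).
have a0 : 0 < a by rewrite ltr_wpDl.
have ab : a < b.
  by rewrite /b ltr_pMr// expR_gt1 divr_gt0// ltr_wpDl.
have := @ln_ratio_le_Rintegral R F a b e iF a0 ab (ltW e0).
have -> : ln b - ln a = (I + 1) / e.
  by rewrite /b lnM ?posrE ?expR_gt0// expRK; ring.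
rewrite mulrCA divff ?gt_eqF// mulr1 => H1; suff : I + 1 <= I.
  by rewrite -[X in _ <= X]addr0 lerD2l ler10.
apply: H1.
  move=> x ax xb; rewrite leNgt; apply/negP => xF; apply: H; exists x => //.
  by apply: lt_le_trans ax; rewrite /a (le_lt_trans (ler_norm M))// ltrDl.
Qed.

Lemma measurable_set_itv {R : realType} (i : interval R) :
  measurable ([set` i] : set R).
Proof. exact: measurable_itv. Qed.

#[local] Hint Resolve measurable_set_itv : core.

(** Dominated convergence for the truncations of [p] to the segments, with [|p|] as dominating
    function. *)
Lemma Rintegral_exhaustion {R : realType} (p : R -> R) (a b : R^nat) :
  (forall n, 0 < a n < n.+1%:R^-1) -> (forall n, n.+1%:R < b n) ->
  integrable_on Rpos p ->
  \int[leb]_(x in `[a n, b n]) p x @[n --> \oo] --> \int[leb]_(x in Rpos) p x.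
Proof.
move=> an bn ip.
have mp : measurable_fun Rpos (EFin \o p) by exact: measurable_int ip.
pose pn n := (EFin \o p) \_ `[a n, b n].
have : [/\ leb.-integrable Rpos (EFin \o p),
    [sequence (\int[leb]_(x in Rpos) `|pn n x - (EFin \o p) x|)%E]_n @ \oo --> 0%E &
    [sequence (\int[leb]_(x in Rpos) pn n x)%E]_n @ \oo -->
      (\int[leb]_(x in Rpos) (EFin \o p) x)%E].
  refine (@dominated_convergence _ _ R leb Rpos _ pn (EFin \o p)
    (fun x => `|(p x)%:E|%E) _ _ _ _ _).
  - exact: measurable_Rpos.
  - move=> n; refine ((measurable_restrict (EFin \o p) (measurable_set_itv _) measurable_Rpos).1 _).
    exact: (measurable_funS measurable_Rpos (@subIsetl _ _ _) mp).
  - exact: mp.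
  - apply: aeW => x; rewrite RposE => x0.
    apply: cvg_near_cst.
    (* Once n + 1 exceeds both x and 1 / x, the point x lies in the n-th segment. *)
    have [N HN] : exists N, forall n, (N <= n)%N -> a n <= x <= b n.
      exists (Num.truncn (Num.max x x^-1)).+1 => n Nn.
      have H : Num.max x x^-1 < n.+1%:R.
        apply: lt_le_trans (truncnS_gt _) _.
        by rewrite ler_nat leqW.
      move: H; rewrite gt_max => /andP[xn xin].
      have /andP[a0 a1] := an n; apply/andP; split; last first.
        exact/ltW/(lt_trans xn).
      apply/ltW/(lt_trans a1).
      by rewrite invf_plt// posrE.
    exists N => // n /HN Hn.
    by rewrite /pn patchE mem_set.
  - exact: integrable_abse.
  - apply: aeW => x n _; rewrite /pn patchE; case: ifPn => //= _.
    by rewrite lee_fin normr0.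
move=> [_ _ cv]; apply: fine_cvg.
rewrite fineK ?integrable_fin_num//.
move: cv; apply: cvg_trans; apply: near_eq_cvg; near=> n.
rewrite /= /pn -integral_mkcondr; congr (integral _ _ _).
apply/seteqP; split=> [x []//|x xab]; split=> //.
by apply: (@segment_Rpos _ (a n) (b n)) xab; have /andP[] := an n.
Unshelve. all: by [end_near|exact: measurable_Rpos]. Qed.

(** Since [x * |T x / x| = |T x|], integrability of [T x / x] provides points [a n] near 0 and [b n]
    near +oo at which [T] is below 1 / (n + 1); the integrals of [p] between them tend to 0. *)
Lemma Rintegral_derive_eq0 {R : realType} (T p : R -> R) :
  (forall x : R, 0 < x -> is_derive x 1 T (p x)) ->
  (forall x : R, 0 < x -> {for x, continuous p}) ->
  integrable_on Rpos p -> integrable_on Rpos (fun x => T x / x) ->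
  \int[leb]_(x in Rpos) p x = 0.
Proof.
move=> dT cp ip iT.
have xT (x : R) : 0 < x -> x * `|T x / x| = `|T x|.
  by move=> x0; rewrite normrM normfV (gtr0_norm x0) mulrC divfK ?gt_eqF.
have ne n : 0 < n.+1%:R^-1 :> R by rewrite invr_gt0.
have exa n : exists a, 0 < a < n.+1%:R^-1 /\ `|T a| < n.+1%:R^-1.
  have [a /andP[a0 an]] := integrable_small_left iT (ne n) (ne n).
  by rewrite xT// => Ta; exists a; rewrite a0.
have exb n : exists b, n.+1%:R < b /\ `|T b| < n.+1%:R^-1.
  have [b bn] := integrable_small_right n.+1%:R iT (ne n).
  by rewrite xT ?(lt_trans _ bn)// => Tb; exists b.
have [a Ha] := choice exa; have [b Hb] := choice exb.
have := Rintegral_exhaustion (fun n => (Ha n).1) (fun n => (Hb n).1) ip.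
move/cvg_lim => <- //; apply/cvg_lim => //.
apply/cvgr0Pnorm_le => e e0; near=> n.
have [/andP[a0 a1] Ta] := Ha n; have [b1 Tb] := Hb n.
have ab : a n < b n.
  apply: (lt_trans a1); apply: le_lt_trans b1.
  by rewrite (le_trans (_ : _ <= 1))// ?invf_le1// ler1n.
rewrite (Rintegral_FTC a0 ab dT cp).
apply: le_trans (ler_normB _ _) _.
apply: le_trans (lerD (ltW Tb) (ltW Ta)) _.
have : n.+1%:R^-1 <= e / 2.
  apply/ltW; near: n; exact: near_infty_natSinv_lt (PosNum (divr_gt0 e0 _)).
by set t := _^-1 => H; lra.
Unshelve. all: by end_near. Qed.

(** * The quadratic identity for functions of class C^2 *)

Section is_derive_lambda.
Context {R : realType}.
Implicit Types (f g : R -> R) (x a b k : R).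

Lemma is_derive_addf f g x a b : is_derive x 1 f a -> is_derive x 1 g b ->
  is_derive x 1 (fun y => f y + g y) (a + b).
Proof. by move=> df dg; exact: is_deriveD. Qed.

Lemma is_derive_mulf f g x a b : is_derive x 1 f a -> is_derive x 1 g b ->
  is_derive x 1 (fun y => f y * g y) (f x * b + g x * a).
Proof. by move=> df dg; exact: is_deriveM. Qed.

Lemma is_derive_scalef k f x a : is_derive x 1 f a ->
  is_derive x 1 (fun y => k * f y) (k * a).
Proof. by move=> df; exact: is_deriveZ. Qed.

Lemma is_derive_sqrf f x a : is_derive x 1 f a ->
  is_derive x 1 (fun y => f y ^+ 2) (2 * f x * a).
Proof. by move=> df; apply: is_derive_eq (is_deriveX 2 df) _. Qed.

Lemma is_derive_affine k a x : is_derive x 1 (fun y => k * y + a) k.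
Proof.
apply: is_derive_eq (is_derive_addf (is_derive_scalef k (is_derive_id x 1))
  (is_derive_cst a x 1)) _.
by rewrite mulr1 addr0.
Qed.

End is_derive_lambda.

Lemma powR_succ {R : realType} (a x : R) : 0 < x -> x `^ a = x `^ (a - 1) * x.
Proof.
move=> x0; rewrite -[X in _ * X](powRr1 (ltW x0)) -powRD.
  by rewrite subrK.
by rewrite (gt_eqF x0) implybT.
Qed.

Definition energy {R : realType} (mu : R) (f f1 f2 : R -> R) (x : R) : R :=
  x `^ (mu - 1) * ((x * f2 x) ^+ 2 + (x * f1 x) ^+ 2 + f1 x ^+ 2 + f x ^+ 2).

Definition kummer_op {R : realType} (mu c l : R) (f f1 f2 : R -> R) (x : R) : R :=
  x * f2 x + (l * x + mu) * f1 x + l * c * f x.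

(* The difference between [x `^ (mu - 1) * kummer_op mu c l f f1 f2 x ^+ 2] and
   the integrand of [A + l ^+ 2 * B - l * (2 * c - mu + 1) * D]; it is the
   derivative of [boundary mu c l f f1] when [f1], [f2] are the derivatives
   of [f]. *)
Definition null_form {R : realType} (mu c l : R) (f f1 f2 : R -> R) (x : R) : R :=
  x `^ (mu - 1) * (2 * l * ((x * f2 x) * (x * f1 x)) + 2 * mu * ((x * f2 x) * f1 x)
   + 2 * l * c * ((x * f2 x) * f x) + mu ^+ 2 * (f1 x * f1 x)
   + l ^+ 2 * c * mu * (f x * f x) + l * (2 * c + mu + 1) * ((x * f1 x) * f1 x)
   + 2 * l ^+ 2 * c * ((x * f1 x) * f x) + 2 * mu * l * c * (f1 x * f x)).

Definition boundary {R : realType} (mu c l : R) (f f1 : R -> R) (x : R) : R :=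
  x `^ mu * ((l * x + mu) * f1 x ^+ 2 + 2 * c * l * (f x * f1 x)
             + c * l ^+ 2 * f x ^+ 2).

Lemma kummer_op_sqr {R : realType} (mu c l : R) (f f1 f2 : R -> R) (x : R) :
  0 < x ->
  x `^ (mu - 1) * kummer_op mu c l f f1 f2 x ^+ 2 =
  f2 x ^+ 2 * x `^ (mu + 1)
  + l ^+ 2 * ((x ^+ 2 * f1 x ^+ 2 - c * (mu - c) * f x ^+ 2) * x `^ (mu - 1))
  - l * (2 * c - mu + 1) * (f1 x ^+ 2 * x `^ mu)
  + null_form mu c l f f1 f2 x.
Proof.
move=> x0; rewrite (powR_succ (mu + 1) x0) addrK (powR_succ mu x0).
by rewrite /null_form /kummer_op; ring.
Qed.

Lemma boundary_derive {R : realType} (mu c l : R) (f f1 f2 : R -> R) (x : R) :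
  0 < x -> is_derive x 1 f (f1 x) -> is_derive x 1 f1 (f2 x) ->
  is_derive x 1 (boundary mu c l f f1) (null_form mu c l f f1 f2 x).
Proof.
move=> x0 df df1.
have d := is_derive_mulf (is_derive1_powR mu x0) (is_derive_addf (is_derive_addf
  (is_derive_mulf (is_derive_affine l mu x) (is_derive_sqrf df1))
  (is_derive_scalef (2 * c * l) (is_derive_mulf df df1)))
  (is_derive_scalef (c * l ^+ 2) (is_derive_sqrf df))).
apply: (is_derive_eq d).
by rewrite /null_form /= (powR_succ mu x0); ring.
Qed.

(** * Pointwise bounds of the quadratic forms by the energy *)

(** The difference is a t + b s - s t, and each product is split by Young's inequality with weight
    [h]. The free [h] plays the role of the Cauchy-Schwarz inequality after integration. *)
Lemma mulf_perturb {R : realType} (a b s t h : R) : 0 < h -> h <= 1 ->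
  `|a * b - (a - s) * (b - t)| <= h * (a ^+ 2 + b ^+ 2) + (s ^+ 2 + t ^+ 2) / h.
Proof.
move=> h0 h1.
have young x y : `|x * y| <= (h * x ^+ 2 + y ^+ 2 / h) / 2.
  have -> : h * x ^+ 2 + y ^+ 2 / h = ((h * x) ^+ 2 + y ^+ 2) / h.
    by field; rewrite gt_eqF.
  rewrite -mulrA -invfM ler_pdivlMr ?mulr_gt0// -(gtr0_norm h0) -normr_nat.
  rewrite -!normrM ler_norml.
  have := sqr_ge0 (h * x - y); have := sqr_ge0 (h * x + y).
  by rewrite !gtr0_norm//; nra.
(* Here h <= 1 is used, in the form h s^2 <= s^2 / h. *)
have : `|s * t| <= (s ^+ 2 + t ^+ 2) / h / 2.
  apply: le_trans (young s t) _; rewrite ler_pM2r ?invr_gt0// mulrDl lerD2r.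
  rewrite ler_pdivlMr// mulrAC -expr2 ler_piMl ?sqr_ge0// expr_le1// ltW//.
have := young a t; have := young b s.
have -> : a * b - (a - s) * (b - t) = a * t + b * s - s * t by ring.
move=> Y1 Y2 Y3; apply: le_trans (ler_normB _ _) _.
apply: le_trans (lerD (ler_normD _ _) (lexx _)) _.
have S : 0 <= h * (a ^+ 2 + b ^+ 2) by rewrite mulr_ge0 ?addr_ge0 ?sqr_ge0// ltW.
move: Y1 Y2 Y3 S; rewrite !mulrDr !mulrDl; lra.
Qed.

Lemma energy_ge0 {R : realType} (mu : R) (f f1 f2 : R -> R) (x : R) :
  0 <= energy mu f f1 f2 x.
Proof. by rewrite mulr_ge0 ?powR_ge0// !addr_ge0 ?sqr_ge0. Qed.

Lemma normB_leD {R : realType} (a b s t p q : R) :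
  `|a - b| <= p -> `|s - t| <= q -> `|a + s - (b + t)| <= p + q.
Proof.
by move=> ab st; rewrite opprD addrACA (le_trans (ler_normD _ _))// lerD.
Qed.

(** Up to the weight, the form is a sum of eight products of two among x f'', x f', f', f, whose
    squares make up the energy; [mulf_perturb] applies to each of them. *)
Lemma null_form_perturb {R : realType} (mu c l : R) :
  exists2 K, 0 <= K & forall (f f1 f2 g g1 g2 : R -> R) (x h : R),
  0 < h -> h <= 1 ->
  `|null_form mu c l f f1 f2 x - null_form mu c l g g1 g2 x|
  <= K * (h * energy mu f f1 f2 x +
          energy mu (f \- g) (f1 \- g1) (f2 \- g2) x / h).
Proof.
(* The coefficients of the eight products, in their order in [null_form]. *)
pose k := [:: 2 * l; 2 * mu; 2 * l * c; mu ^+ 2; l ^+ 2 * c * mu;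
  l * (2 * c + mu + 1); 2 * l ^+ 2 * c; 2 * mu * l * c].
exists (2 * \sum_(i <- k) `|i|) => [|f f1 f2 g g1 g2 x h h0 h1].
  by rewrite mulr_ge0// sumr_ge0.
set A := x * f2 x; set B := x * f1 x.
set A' := x * (f2 x - g2 x); set B' := x * (f1 x - g1 x).
pose n := A ^+ 2 + B ^+ 2 + f1 x ^+ 2 + f x ^+ 2.
pose n' := A' ^+ 2 + B' ^+ 2 + (f1 x - g1 x) ^+ 2 + (f x - g x) ^+ 2.
(* One product at a time. The bounds are [2 * n] and [2 * n'] because the two factors may coincide,
   as in [f1 x * f1 x]. *)
have P (q a b s t : R) : a ^+ 2 + b ^+ 2 <= 2 * n -> s ^+ 2 + t ^+ 2 <= 2 * n' ->
   `|q * (a * b) - q * ((a - s) * (b - t))| <= `|q| * (2 * (h * n + n' / h)).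
  move=> abn stn; rewrite -mulrBr normrM ler_wpM2l//.
  apply: le_trans (mulf_perturb _ _ _ _ h0 h1) _.
  rewrite [leRHS]mulrDr lerD//; first by rewrite [leRHS]mulrCA ler_pM2l.
  by rewrite [leRHS]mulrA ler_pM2r ?invr_gt0.
have A0 := sqr_ge0 A; have B0 := sqr_ge0 B; have f10 := sqr_ge0 (f1 x).
have f0 := sqr_ge0 (f x); have A'0 := sqr_ge0 A'; have B'0 := sqr_ge0 B'.
have g10 := sqr_ge0 (f1 x - g1 x); have g0 := sqr_ge0 (f x - g x).
have p0 := powR_ge0 x (mu - 1).
rewrite /null_form /energy /= -/A -/B -/A' -/B' -mulrBr normrM (ger0_norm p0).
rewrite -/n -/n'.
set S := \sum_(i <- k) _.
have -> : 2 * S * (h * (x `^ (mu - 1) * n) + x `^ (mu - 1) * n' / h) =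
  x `^ (mu - 1) * (S * (2 * (h * n + n' / h))) by ring.
rewrite ler_wpM2l// /S mulr_suml /k !big_cons big_nil addr0.
have -> : x * g2 x = A - A' by rewrite /A /A'; ring.
have -> : x * g1 x = B - B' by rewrite /B /B'; ring.
rewrite -[g1 x](subKr (f1 x)) -[g x](subKr (f x)).
rewrite !addrA; do 7 (apply: normB_leD; last by apply: P; rewrite /n /n'; lra).
by apply: P; rewrite /n /n'; lra.
Qed.

(** The case g = 0, h = 1 of the perturbation bound, where both energies are that of f. *)
Lemma null_form_bound {R : realType} (mu c l : R) :
  exists2 K, 0 <= K & forall (f f1 f2 : R -> R) (x : R),
    `|null_form mu c l f f1 f2 x| <= K * energy mu f f1 f2 x.
Proof.
have [K K0 HK] := null_form_perturb mu c l.
exists (2 * K) => [|f f1 f2 x]; first by rewrite mulr_ge0.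
have := HK f f1 f2 (cst 0) (cst 0) (cst 0) x 1 ltr01 (lexx 1).
have -> : null_form mu c l (cst 0) (cst 0) (cst 0) x = 0.
  by rewrite /null_form /=; ring.
by rewrite subr0 /energy /= !subr0 divr1 mul1r; congr (_ <= _); ring.
Qed.

(** Division by x turns the weight x^mu into x^(mu-1); what remains is a quadratic form in x f', f',
    f. *)
Lemma boundary_bound {R : realType} (mu c l : R) :
  exists2 K, 0 <= K & forall (f f1 f2 : R -> R) (x : R), 0 < x ->
    `|boundary mu c l f f1 x / x| <= K * energy mu f f1 f2 x.
Proof.
exists (`|l| + `|mu| + `|2 * c * l| + `|c * l ^+ 2|); first by rewrite !addr_ge0.
move=> f f1 f2 x x0.
set n := (x * f2 x) ^+ 2 + (x * f1 x) ^+ 2 + f1 x ^+ 2 + f x ^+ 2.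
have -> : boundary mu c l f f1 x / x = x `^ (mu - 1) *
   (l * ((x * f1 x) * f1 x) + mu * (f1 x * f1 x) + 2 * c * l * (f x * f1 x)
    + c * l ^+ 2 * (f x * f x)).
  rewrite /boundary (powR_succ mu x0) mulrAC mulfK ?gt_eqF//; congr (_ * _); ring.
have A0 := sqr_ge0 (x * f2 x); have B0 := sqr_ge0 (x * f1 x).
have f10 := sqr_ge0 (f1 x); have f0 := sqr_ge0 (f x).
have P (q a b : R) : a ^+ 2 + b ^+ 2 <= 2 * n -> `|q * (a * b)| <= `|q| * n.
  move=> abn; rewrite normrM ler_wpM2l// ler_norml.
  have := sqr_ge0 (a + b); have := sqr_ge0 (a - b); nra.
rewrite normrM (ger0_norm (powR_ge0 _ _)) /energy [leRHS]mulrCA ler_wpM2l ?powR_ge0//.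
rewrite -/n !(mulrDl _ _ n).
do 3 (apply: le_trans (ler_normD _ _) _; apply: lerD;
  last by apply: P; rewrite /n; lra).
by apply: P; rewrite /n; lra.
Qed.

Section integrable_on_algebra.
Context {R : realType} (D : set R) (mD : measurable D).
Implicit Types F G : R -> R.

Lemma integrable_on_scale k F :
  integrable_on D F -> integrable_on D (fun x => k * F x).
Proof. by move=> iF; apply: (integrableZl _ k iF). Qed.

Lemma integrable_on_add F G : integrable_on D F -> integrable_on D G ->
  integrable_on D (fun x => F x + G x).
Proof. by move=> iF iG; apply: (integrableD _ iF iG). Qed.

Lemma integrable_on_sub F G : integrable_on D F -> integrable_on D G ->
  integrable_on D (fun x => F x - G x).
Proof. by move=> iF iG; apply: (integrableB _ iF iG). Qed.

Lemma Rintegral_scale k F : integrable_on D F ->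
  \int[leb]_(x in D) (k * F x) = k * \int[leb]_(x in D) F x.
Proof. by move=> iF; apply: RintegralZl. Qed.

Lemma Rintegral_add F G : integrable_on D F -> integrable_on D G ->
  \int[leb]_(x in D) (F x + G x) = \int[leb]_(x in D) F x + \int[leb]_(x in D) G x.
Proof. by move=> iF iG; apply: RintegralD. Qed.

Lemma Rintegral_sub F G : integrable_on D F -> integrable_on D G ->
  \int[leb]_(x in D) (F x - G x) = \int[leb]_(x in D) F x - \int[leb]_(x in D) G x.
Proof. by move=> iF iG; apply: RintegralB. Qed.

Lemma normr_Rintegral_le F : integrable_on D F ->
  `|\int[leb]_(x in D) F x| <= \int[leb]_(x in D) `|F x|.
Proof. by move=> iF; apply: le_normr_Rintegral. Qed.

Lemma Rintegral_le F G : integrable_on D F -> integrable_on D G ->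
  (forall x, D x -> F x <= G x) ->
  \int[leb]_(x in D) F x <= \int[leb]_(x in D) G x.
Proof. by move=> iF iG FG; apply: le_Rintegral. Qed.

End integrable_on_algebra.

Lemma measurable_powR_Rpos {R : realType} (a : R) :
  measurable_fun Rpos (fun x : R => x `^ a).
Proof. exact: (measurable_funTS (measurable_powR a)). Qed.

Lemma measurable_id_Rpos {R : realType} : measurable_fun Rpos (fun x : R => x).
Proof. by apply: measurable_funTS; exact: measurable_id. Qed.

Lemma measurable_energy {R : realType} (mu : R) (f f1 f2 : R -> R) :
  measurable_fun Rpos f -> measurable_fun Rpos f1 -> measurable_fun Rpos f2 ->
  measurable_fun Rpos (energy mu f f1 f2).
Proof.
move=> mf mf1 mf2.
have mp := @measurable_powR_Rpos R (mu - 1); have mx := @measurable_id_Rpos R.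
apply: measurable_funM => //.
by repeat apply: measurable_funD; apply: measurable_funX => //; apply: measurable_funM.
Qed.

Lemma measurable_null_form {R : realType} (mu c l : R) (f f1 f2 : R -> R) :
  measurable_fun Rpos f -> measurable_fun Rpos f1 -> measurable_fun Rpos f2 ->
  measurable_fun Rpos (null_form mu c l f f1 f2).
Proof.
move=> mf mf1 mf2.
have mp := @measurable_powR_Rpos R (mu - 1); have mx := @measurable_id_Rpos R.
have mM1 : measurable_fun Rpos (fun x => x * f1 x) by exact: measurable_funM.
have mM2 : measurable_fun Rpos (fun x => x * f2 x) by exact: measurable_funM.
apply: measurable_funM => //.
by repeat apply: measurable_funD; (apply: measurable_funM => //; exact: measurable_funM).
Qed.

(** * The integral of the null form vanishes *)

(** Explicit derivatives allow the same notion to cover smooth approximants, solutions in closed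
    form, and f with a continuous version of its weak second derivative. *)
Definition C2_derivatives {R : realType} (u u1 u2 : R -> R) : Prop :=
  forall x : R, 0 < x ->
    [/\ is_derive x 1 u (u1 x), is_derive x 1 u1 (u2 x) & {for x, continuous u2}].

Section C2.
Context {R : realType} (mu c l : R) (u u1 u2 : R -> R).
Context (C2u : C2_derivatives u u1 u2).

Lemma C2_continuous (x : R) : 0 < x -> {for x, continuous u}.
Proof. by move=> /C2u[du _ _]; exact: is_derive_continuous du. Qed.

Lemma C2_continuous1 (x : R) : 0 < x -> {for x, continuous u1}.
Proof. by move=> /C2u[_ du _]; exact: is_derive_continuous du. Qed.

Lemma C2_continuous2 (x : R) : 0 < x -> {for x, continuous u2}.
Proof. by move=> /C2u[]. Qed.

Lemma C2_measurable :
  [/\ measurable_fun Rpos u, measurable_fun Rpos u1 & measurable_fun Rpos u2].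
Proof.
split; apply: measurable_Rpos_continuous.
- exact: C2_continuous.
- exact: C2_continuous1.
- exact: C2_continuous2.
Qed.

Lemma C2_null_form_continuous (x : R) : 0 < x ->
  {for x, continuous (null_form mu c l u u1 u2)}.
Proof.
move=> x0; have cu := C2_continuous x0; have cu1 := C2_continuous1 x0.
have cu2 := C2_continuous2 x0.
have cp : {for x, continuous (fun y : R => y `^ (mu - 1))}.
  by have := is_derive1_powR (mu - 1) x0; exact: is_derive_continuous.
have c1 : {for x, continuous (fun y : R => y * u1 y)} by apply: cvgM => //; exact: cvg_id.
have c2 : {for x, continuous (fun y : R => y * u2 y)} by apply: cvgM => //; exact: cvg_id.
apply: cvgM => //.
by repeat apply: cvgD; (apply: cvgM; [exact: cvg_cst|exact: cvgM]).
Qed.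

Lemma Rintegral_null_form_C2 :
  integrable_on Rpos (energy mu u u1 u2) ->
  integrable_on Rpos (null_form mu c l u u1 u2) /\
  \int[leb]_(x in Rpos) null_form mu c l u u1 u2 x = 0.
Proof.
move=> iE; have [mu0 mu1 mu2] := C2_measurable.
have [K K0 HK] := null_form_bound mu c l.
have [K' K'0 HK'] := boundary_bound mu c l.
have iZ (k : R) : integrable_on Rpos (fun x => k * energy mu u u1 u2 x).
  exact: integrable_on_scale.
have iN : integrable_on Rpos (null_form mu c l u u1 u2).
  apply: integrable_le (iZ K) _ => //; exact: measurable_null_form.
have db (x : R) (x0 : 0 < x) : is_derive x 1 (boundary mu c l u u1) (null_form mu c l u u1 u2 x).
  by have [du du1 _] := C2u x0; exact: boundary_derive.
split=> //; apply: (Rintegral_derive_eq0 db _ iN).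
  exact: C2_null_form_continuous.
apply: integrable_le (iZ K') _ => //; last first.
  by move=> x; rewrite RposE; exact: HK'.
apply: measurable_Rpos_continuous => x x0; apply: cvgM.
  exact: is_derive_continuous (db x x0).
by apply: cvgV; [rewrite gt_eqF|exact: cvg_id].
Qed.

End C2.

(** [Ecompletion] restated with real-valued integrals: the squared norm replaces the norm, and the
    approximants are only of class C^2. *)
Definition energy_closure {R : realType} (mu : R) (f f1 f2 : R -> R) : Prop :=
  [/\ [/\ measurable_fun Rpos f, measurable_fun Rpos f1 & measurable_fun Rpos f2],
      integrable_on Rpos (energy mu f f1 f2) &
      forall h : R, 0 < h -> exists u u1 u2 : R -> R,
        [/\ C2_derivatives u u1 u2, integrable_on Rpos (energy mu u u1 u2),
            integrable_on Rpos (energy mu (f \- u) (f1 \- u1) (f2 \- u2)) &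
            \int[leb]_(x in Rpos) energy mu (f \- u) (f1 \- u1) (f2 \- u2) x <= h]].

(** The integral vanishes for each approximant, and the perturbation bound makes [J] at most a
    constant times [h], for every h in (0, 1]. *)
Lemma Rintegral_null_form {R : realType} (mu c l : R) (f f1 f2 : R -> R) :
  energy_closure mu f f1 f2 ->
  integrable_on Rpos (null_form mu c l f f1 f2) /\
  \int[leb]_(x in Rpos) null_form mu c l f f1 f2 x = 0.
Proof.
move=> [[mf mf1 mf2] iE app].
have [K K0 HK] := null_form_perturb mu c l.
have [K' K'0 HK'] := null_form_bound mu c l.
have iN : integrable_on Rpos (null_form mu c l f f1 f2).
  have iZ : integrable_on Rpos (fun x => K' * energy mu f f1 f2 x).
    exact: integrable_on_scale.
  apply: integrable_le iZ _ => //; exact: measurable_null_form.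
split=> //; set J := \int[leb]_(x in _) _.
set N := \int[leb]_(x in Rpos) energy mu f f1 f2 x.
have N0 : 0 <= N by apply: Rintegral_ge0 => x _; exact: energy_ge0.
have JK (h : R) : 0 < h -> h <= 1 -> `|J| <= h * (K * (N + 1)).
  (* The approximation has accuracy h^2, so that the term of the perturbation bound divided by h is
     still of order h. *)
  move=> h0 h1; have [u [u1 [u2 [C2u iu id dh]]]] := app (h ^+ 2) (exprn_gt0 2 h0).
  have [iNu Ju] := Rintegral_null_form_C2 c l C2u iu.
  have -> : J = \int[leb]_(x in Rpos) (null_form mu c l f f1 f2 x - null_form mu c l u u1 u2 x).
    by rewrite Rintegral_sub// Ju subr0.
  set g := fun x => K * (h * energy mu f f1 f2 x +
    h^-1 * energy mu (f \- u) (f1 \- u1) (f2 \- u2) x).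
  have i1 : integrable_on Rpos (fun x => h * energy mu f f1 f2 x).
    exact: integrable_on_scale.
  have i2 : integrable_on Rpos (fun x => h^-1 * energy mu (f \- u) (f1 \- u1) (f2 \- u2) x).
    exact: integrable_on_scale.
  have i12 := integrable_on_add measurable_Rpos i1 i2.
  have ig : integrable_on Rpos g by exact: integrable_on_scale.
  have iB : integrable_on Rpos (fun x => null_form mu c l f f1 f2 x - null_form mu c l u u1 u2 x).
    exact: integrable_on_sub.
  apply: le_trans (normr_Rintegral_le measurable_Rpos iB) _.
  apply: (@le_trans _ _ (\int[leb]_(x in Rpos) g x)).
    apply: Rintegral_le => //; first exact: integrable_norm.
    by move=> x _; rewrite /g [h^-1 * _]mulrC; exact: HK.
  rewrite !(Rintegral_scale, Rintegral_add)//.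
  rewrite mulrCA ler_wpM2l//.
  rewrite mulrDr mulr1 lerD2l mulrC ler_pdivrMr// -expr2.
apply/eqP; rewrite -normr_le0 leNgt; apply/negP => J0.
(* The added 1 makes [M] positive, so that [h] below can be taken with [h * M] at most half of
   [|J|]. *)
pose M := K * (N + 1) + 1.
have M0 : 0 < M by rewrite ltr_wpDl// mulr_ge0// addr_ge0.
pose h := Num.min 1 (`|J| / 2 / M).
have h0 : 0 < h by rewrite lt_min ltr01 !divr_gt0.
have h1 : h <= 1 by rewrite ge_min lexx.
have := JK h h0 h1; rewrite leNgt => /negP; apply.
have hM : h * M <= `|J| / 2 by rewrite -ler_pdivlMr// ge_min lexx orbT.
apply: (@le_lt_trans _ _ (h * M)); first by rewrite ler_pM2l// lerDl.
by apply: le_lt_trans hM _; rewrite ltr_pdivrMr// mulr_natr mulr2n ltrDl.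
Qed.

(** * The identity on the completion *)

Lemma Rpos_derive1B {R : realType} (f g : R -> R) (x : R) :
  derivable f x 1 -> derivable g x 1 ->
  (f \- g)^`()%classic x = f^`()%classic x - g^`()%classic x.
Proof. by move=> df dg; rewrite !derive1E deriveB. Qed.

Lemma Enorm_energy {R : realType} (mu : R) (f f2 : R -> R) :
  Enorm mu f f2 =
  sqrte (\int[leb]_(x in Rpos) (energy mu f f^`()%classic f2 x)%:E)%E.
Proof.
congr sqrte; apply: eq_integral => x; rewrite mem_Rpos => x0; congr EFin.
rewrite /energy (powR_succ (mu + 1) x0) addrK (powR_succ mu x0); ring.
Qed.

(** [f1] is separate from the derivative of [f] because, for a difference, the derivative of the
    difference equals the difference of the derivatives only on (0, +oo). *)
Lemma integrable_Enorm_lt {R : realType} (mu h : R) (f f1 f2 : R -> R) :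
  measurable_fun Rpos f -> measurable_fun Rpos f1 -> measurable_fun Rpos f2 ->
  (forall x : R, 0 < x -> f1 x = f^`()%classic x) ->
  (Enorm mu f f2 <= h%:E)%E ->
  integrable_on Rpos (energy mu f f1 f2) /\
  \int[leb]_(x in Rpos) energy mu f f1 f2 x <= h ^+ 2.
Proof.
move=> mf mf1 mf2 f1E; rewrite Enorm_energy.
have -> : (\int[leb]_(x in Rpos) (energy mu f f^`()%classic f2 x)%:E =
          \int[leb]_(x in Rpos) (energy mu f f1 f2 x)%:E)%E.
  by apply: eq_integral => x; rewrite mem_Rpos => x0; rewrite /energy f1E.
set I := (\int[leb]_(x in Rpos) _)%E => Ih.
have I0 : (0 <= I)%E by apply: integral_ge0 => x _; rewrite lee_fin energy_ge0.
have Ih2 : (I <= (h ^+ 2)%:E)%E.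
  rewrite -(sqr_sqrte I0) EFin_expe.
  by rewrite !expe2 lee_pmul ?sqrte_ge0.
split.
  apply/integrableP; split; first by apply/measurable_EFinP; exact: measurable_energy.
  under eq_integral do rewrite /= ger0_norm ?energy_ge0//.
  exact: le_lt_trans Ih2 (ltry _).
rewrite /Rintegral -lee_fin fineK// ge0_fin_numE//.
exact: le_lt_trans Ih2 (ltry _).
Qed.

Lemma smooth_C2_derivatives {R : realType} (u : R -> R) : smooth_on Rpos u ->
  C2_derivatives u u^`()%classic u^`(2)%classic.
Proof.
move=> su x x0; have Rx : Rpos x by rewrite RposE.
split.
- by apply: DeriveDef; [exact: su 0%N x Rx|rewrite derive1E].
- by apply: DeriveDef; [exact: su 1%N x Rx|rewrite /= !derive1E].
- exact/differentiable_continuous/derivable1_diffP/(su 2%N x Rx).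
Qed.

Lemma Ecompletion_energy_closure {R : realType} (mu : R) (f f2 : R -> R) :
  Ecompletion mu f f2 -> energy_closure mu f f^`()%classic f2.
Proof.
move=> [C1f [_ [mf2 _ _] _] [u [Eu cvu]]].
have cf (x : R) : 0 < x -> {for x, continuous f}.
  move=> x0; have /C1f[df _] : Rpos x by rewrite RposE.
  exact/differentiable_continuous/derivable1_diffP.
have cf1 (x : R) : 0 < x -> {for x, continuous f^`()%classic}.
  by move=> x0; have /C1f[] : Rpos x by rewrite RposE.
have mf := measurable_Rpos_continuous cf.
have mf1 := measurable_Rpos_continuous cf1.
have app (h : R) : 0 < h -> exists v : R -> R,
  [/\ C2_derivatives v v^`()%classic v^`(2)%classic,
    integrable_on Rpos (energy mu v v^`()%classic v^`(2)%classic),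
    integrable_on Rpos (energy mu (f \- v) (f^`()%classic \- v^`()%classic)
      (f2 \- v^`(2)%classic)) &
    \int[leb]_(x in Rpos) energy mu (f \- v) (f^`()%classic \- v^`()%classic)
      (f2 \- v^`(2)%classic) x <= h].
  (* [Enorm] is the square root of the integrated energy, hence the threshold [Num.sqrt h]. *)
  move=> h0; have s0 : 0 < Num.sqrt h by rewrite sqrtr_gt0.
  have [n Hn] : exists n, (Enorm mu (f \- u n)%R (f2 \- (u n)^`(2)%classic)%R <= (Num.sqrt h)%:E)%E.
    move/fine_cvgP : cvu => [fin /cvgr0Pnorm_le/(_ _ s0) le].
    have [n [/= fn ln]] := filter_ex (filterI fin le).
    exists n; rewrite -(fineK fn) lee_fin; exact: le_trans (ler_norm _) ln.
  have [su /ltW fu] := Eu n; have C2u := smooth_C2_derivatives su.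
  have [mu0 mu1 mu2] := C2_measurable C2u.
  exists (u n).
  have /fineK Ef : Enorm mu (u n) (u n)^`(2)%classic \is a fin_num.
    by rewrite ge0_fin_numE ?sqrte_ge0//; exact: (Eu n).2.
  have Ele : (Enorm mu (u n) (u n)^`(2)%classic <=
      (fine (Enorm mu (u n) (u n)^`(2)%classic))%:E)%E by rewrite Ef.
  have [iu _] := integrable_Enorm_lt mu0 mu1 mu2 (fun _ _ => erefl) Ele.
  have dE (x : R) : 0 < x -> (f^`()%classic \- (u n)^`()%classic) x = (f \- u n)^`()%classic x.
    move=> x0; have Rx : Rpos x by rewrite RposE.
    by rewrite Rpos_derive1B//; [exact: (C1f x Rx).1|exact: (su 0%N x Rx)].
  have [iE le] := integrable_Enorm_lt (measurable_funB mf mu0)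
    (measurable_funB mf1 mu1) (measurable_funB mf2 mu2) dE Hn.
  by split=> //; move: le; rewrite (sqr_sqrtr (ltW h0)).
split=> //; last first.
  by move=> h h0; have [v Hv] := app h h0; exists v, v^`()%classic, v^`(2)%classic.
(* Finite energy of f comes from a single approximant v, through a^2 <= 2 ((a - b)^2 + b^2). *)
have [v [C2v iv id _]] := app 1 ltr01.
apply: (@integrable_le R _ _ (fun x => 2 * energy mu (f \- v) (f^`()%classic \- v^`()%classic)
      (f2 \- v^`(2)%classic) x + 2 * energy mu v v^`()%classic v^`(2)%classic x)) => //.
- exact: measurable_energy.
- by apply: integrable_on_add => //; exact: integrable_on_scale.
- move=> x _; rewrite ger0_norm ?energy_ge0// /energy /= !(mulrCA 2) -mulrDr.
  rewrite ler_wpM2l ?powR_ge0// -!mulrDr.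
  have S (a b : R) : a ^+ 2 <= 2 * ((a - b) ^+ 2 + b ^+ 2).
    have := sqr_ge0 (a - 2 * b); nra.
  have := S (x * f2 x) (x * v^`(2)%classic x).
  have := S (x * f^`()%classic x) (x * v^`()%classic x).
  have := S (f^`()%classic x) (v^`()%classic x).
  have := S (f x) (v x).
  rewrite !mulrBr /=; lra.
Qed.

Lemma integrable_on_eq {R : realType} (D : set R) (F G : R -> R) :
  measurable D -> (forall x, x \in D -> F x = G x) ->
  integrable_on D G -> integrable_on D F.
Proof.
move=> mD FG iG; apply: eq_integrable iG; first exact: mD.
by move=> x xD; rewrite /= FG.
Qed.

Section quadratic_identity.
Context {R : realType} (mu c : R) (f f1 f2 : R -> R).
Context (cl : energy_closure mu f f1 f2).

Let mf : measurable_fun Rpos f. Proof. by case: cl => -[]. Qed.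
Let mf1 : measurable_fun Rpos f1. Proof. by case: cl => -[]. Qed.
Let mf2 : measurable_fun Rpos f2. Proof. by case: cl => -[]. Qed.
Let iE : integrable_on Rpos (energy mu f f1 f2). Proof. by case: cl. Qed.

Lemma integrable_f2_sqr : integrable_on Rpos (fun x => f2 x ^+ 2 * x `^ (mu + 1)).
Proof.
apply: integrable_le iE _ => //.
  by apply: measurable_funM; [exact: measurable_funX|exact: measurable_powR_Rpos].
move=> x; rewrite RposE => x0; rewrite normrM (ger0_norm (sqr_ge0 _)) (ger0_norm (powR_ge0 _ _)).
rewrite (powR_succ (mu + 1) x0) addrK (powR_succ mu x0) /energy.
have -> : f2 x ^+ 2 * (x `^ (mu - 1) * x * x) = x `^ (mu - 1) * (x * f2 x) ^+ 2 by ring.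
rewrite ler_wpM2l ?powR_ge0//.
have := sqr_ge0 (x * f1 x); have := sqr_ge0 (f1 x); have := sqr_ge0 (f x); lra.
Qed.

Lemma integrable_f1_sqr : integrable_on Rpos (fun x => f1 x ^+ 2 * x `^ mu).
Proof.
apply: integrable_le iE _ => //.
  by apply: measurable_funM; [exact: measurable_funX|exact: measurable_powR_Rpos].
move=> x; rewrite RposE => x0; rewrite normrM (ger0_norm (sqr_ge0 _)) (ger0_norm (powR_ge0 _ _)).
rewrite (powR_succ mu x0) /energy mulrCA -mulrA ler_wpM2l ?powR_ge0//.
have := sqr_ge0 (x * f1 x - f1 x); have := sqr_ge0 (x * f2 x).
have := sqr_ge0 (x * f1 x); have := sqr_ge0 (f1 x); have := sqr_ge0 (f x); nra.
Qed.

(** This part of the energy excludes nonzero constants, and solutions of the equation that are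
    singular at 0. *)
Lemma integrable_f_sqr :
  integrable_on Rpos (fun x => x `^ (mu - 1) * (f1 x ^+ 2 + f x ^+ 2)).
Proof.
apply: integrable_le iE _ => //.
  apply: measurable_funM; [exact: measurable_powR_Rpos|].
  by apply: measurable_funD; exact: measurable_funX.
move=> x; rewrite RposE => x0.
rewrite ger0_norm; last by rewrite mulr_ge0 ?powR_ge0// addr_ge0 ?sqr_ge0.
rewrite /energy ler_wpM2l ?powR_ge0//.
have := sqr_ge0 (x * f1 x); have := sqr_ge0 (x * f2 x); lra.
Qed.

Lemma integrable_B :
  integrable_on Rpos (fun x => (x ^+ 2 * f1 x ^+ 2 - c * (mu - c) * f x ^+ 2) * x `^ (mu - 1)).
Proof.
have := integrable_on_scale measurable_Rpos (1 + `|c * (mu - c)|) iE.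
move=> iK; apply: integrable_le iK _ => //.
  apply: measurable_funM; last exact: measurable_powR_Rpos.
  apply: measurable_funB; apply: measurable_funM.
  - by apply: measurable_funX; exact: measurable_id_Rpos.
  - exact: measurable_funX.
  - exact: measurable_cst.
  - exact: measurable_funX.
move=> x; rewrite RposE => x0; rewrite normrM (ger0_norm (powR_ge0 _ _)) /energy.
rewrite [leLHS]mulrC [leRHS]mulrCA ler_wpM2l ?powR_ge0// (le_trans (ler_normB _ _))//.
rewrite mulrDl mul1r (normrM (c * (mu - c))); apply: lerD.
  rewrite -exprMn ger0_norm ?sqr_ge0//.
  have := sqr_ge0 (x * f2 x); have := sqr_ge0 (f1 x); have := sqr_ge0 (f x); lra.
rewrite ler_wpM2l// ger0_norm ?sqr_ge0//.
have := sqr_ge0 (x * f1 x); have := sqr_ge0 (x * f2 x); have := sqr_ge0 (f1 x); lra.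
Qed.

(** Stated in terms of [c] alone: [c * (mu - c)] stands for eps and [2 * c - mu + 1] for s + 1, so
    that no square root enters. *)
Lemma quadratic_identity l :
  let F x := x `^ (mu - 1) * kummer_op mu c l f f1 f2 x ^+ 2 in
  integrable_on Rpos F /\
  \int[leb]_(x in Rpos) F x =
    \int[leb]_(x in Rpos) (f2 x ^+ 2 * x `^ (mu + 1))
    + l ^+ 2 * \int[leb]_(x in Rpos)
        ((x ^+ 2 * f1 x ^+ 2 - c * (mu - c) * f x ^+ 2) * x `^ (mu - 1))
    - l * (2 * c - mu + 1) * \int[leb]_(x in Rpos) (f1 x ^+ 2 * x `^ mu).
Proof.
move=> F; have [iN N0] := Rintegral_null_form c l cl.
have i2 := integrable_f2_sqr; have i1 := integrable_f1_sqr; have iB := integrable_B.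
pose G x := f2 x ^+ 2 * x `^ (mu + 1)
  + l ^+ 2 * ((x ^+ 2 * f1 x ^+ 2 - c * (mu - c) * f x ^+ 2) * x `^ (mu - 1))
  - l * (2 * c - mu + 1) * (f1 x ^+ 2 * x `^ mu)
  + null_form mu c l f f1 f2 x.
have FG x : x \in Rpos -> F x = G x.
  by rewrite mem_Rpos => x0; rewrite /F kummer_op_sqr.
have j1 := integrable_on_scale measurable_Rpos (l * (2 * c - mu + 1)) i1.
have jB := integrable_on_scale measurable_Rpos (l ^+ 2) iB.
have j2B := integrable_on_add measurable_Rpos i2 jB.
have j2B1 := integrable_on_sub measurable_Rpos j2B j1.
have iG : integrable_on Rpos G by exact: integrable_on_add.
split.
  exact: (integrable_on_eq measurable_Rpos FG iG).
have -> : \int[leb]_(x in Rpos) F x = \int[leb]_(x in Rpos) G x.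
  by apply: eq_Rintegral => x; exact: FG.
rewrite /G (Rintegral_add measurable_Rpos j2B1 iN) N0 addr0.
rewrite (Rintegral_sub measurable_Rpos j2B j1) (Rintegral_add measurable_Rpos i2 jB).
by rewrite (Rintegral_scale measurable_Rpos _ iB) (Rintegral_scale measurable_Rpos _ i1).
Qed.

End quadratic_identity.

(** * Primitives and almost everywhere equalities *)

Lemma Rintegral_segment_cst {R : realType} (a b k : R) : a <= b ->
  \int[leb]_(x in `[a, b]) k = k * (b - a).
Proof.
move=> ab; have E : lebesgue_measure (`[a, b]%classic : set R) = (b - a)%:E.
  by rewrite lebesgue_measure_itv /= lte_fin; case: ltgtP ab => // ->; rewrite subrr.
transitivity (k * fine (lebesgue_measure (`[a, b]%classic : set R))); last by rewrite E.
by apply: Rintegral_cst.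
Qed.

Lemma integrable_segment_cst {R : realType} (a b k : R) :
  integrable_on `[a, b] (fun=> k).
Proof.
apply: continuous_compact_integrable; first exact: segment_compact.
by apply: continuous_subspaceT => x; exact: cvg_cst.
Qed.

Lemma powR_segment_lb {R : realType} (p a b : R) : 0 < a -> a < b ->
  exists2 m, 0 < m & forall x, a <= x -> x <= b -> m <= x `^ p.
Proof.
move=> a0 ab.
have cp (x : R) : 0 < x -> {for x, continuous (fun y : R => y `^ p)}.
  by move=> x0; have := is_derive1_powR p x0; exact: is_derive_continuous.
have [z zab Hz] := EVT_min (ltW ab) (continuous_Rpos_segment (b := b) a0 cp).
exists (z `^ p) => [|x ax xb]; last by apply: Hz; rewrite in_itv /= ax.
by apply: powR_gt0; move: zab; rewrite in_itv /= => /andP[az _]; exact: lt_le_trans az.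
Qed.

(** On a segment away from 0 the weights are bounded below, so the energy controls v^2 for v = [g1],
    [g2], and |v| <= h + v^2 / h turns this into an L^1 bound with a free parameter [h]. *)
Lemma Rintegral_segment_energy {R : realType} (mu a b : R) : 0 < a -> a < b ->
  exists2 m, 0 < m & forall (g g1 g2 : R -> R) (h : R), 0 < h ->
    measurable_fun Rpos g1 -> measurable_fun Rpos g2 ->
    integrable_on Rpos (energy mu g g1 g2) ->
    let N := \int[leb]_(x in Rpos) energy mu g g1 g2 x in
    (integrable_on `[a, b] g1 /\ \int[leb]_(x in `[a, b]) `|g1 x| <= h * (b - a) + N / (m * h))
    /\ (integrable_on `[a, b] g2 /\ \int[leb]_(x in `[a, b]) `|g2 x| <= h * (b - a) + N / (m * h)).
Proof.
move=> a0 ab; have [m m0 Hm] := powR_segment_lb (mu - 1) a0 ab.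
(* In the energy, [g1] has weight at least [m], and [g2] carries an extra x^2, at least a^2. *)
pose k := m * Num.min 1 (a ^+ 2).
have k0 : 0 < k by rewrite mulr_gt0// lt_min ltr01 exprn_gt0.
exists k => // g g1 g2 h h0 mg1 mg2 iE N.
have sub := @segment_Rpos R a b a0.
have iab : integrable_on `[a, b] (energy mu g g1 g2) by exact: integrable_on_segment.
have NE : \int[leb]_(x in `[a, b]) energy mu g g1 g2 x <= N.
  have := le_Rintegral_norm_subset (measurable_set_itv `[a, b]) measurable_Rpos sub iE.
  have E D : \int[leb]_(x in D) `|energy mu g g1 g2 x| = \int[leb]_(x in D) energy mu g g1 g2 x.
    by apply: eq_Rintegral => x _; rewrite ger0_norm// energy_ge0.
  by rewrite !E.
have main (v : R -> R) : measurable_fun Rpos v ->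
    (forall x, a <= x -> x <= b -> k * v x ^+ 2 <= energy mu g g1 g2 x) ->
    integrable_on `[a, b] v /\ \int[leb]_(x in `[a, b]) `|v x| <= h * (b - a) + N / (k * h).
  move=> mv Hv.
  pose G x := h + (k * h)^-1 * energy mu g g1 g2 x.
  have mab : measurable (`[a, b]%classic : set R) by exact: measurable_itv.
  have iG : integrable_on `[a, b] G.
    apply: integrable_on_add => //; first exact: integrable_segment_cst.
    exact: integrable_on_scale.
  have vG x : `[a, b]%classic x -> `|v x| <= G x.
    rewrite /= in_itv /= => /andP[ax xb].
    have : h * `|v x| <= h ^+ 2 + `|v x| ^+ 2.
      have := sqr_ge0 (h - `|v x|); have := normr_ge0 (v x); nra.
    rewrite real_normK ?num_real// => H.
    rewrite -(ler_pM2l h0) (le_trans H)// /G mulrDr expr2 lerD2l.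
    have -> : h * ((k * h)^-1 * energy mu g g1 g2 x) = k^-1 * energy mu g g1 g2 x.
      by field; rewrite !gt_eqF.
    by rewrite ler_pdivlMl// Hv.
  have iv : integrable_on `[a, b] v.
    apply: integrable_le iG vG => //; exact: (measurable_funS measurable_Rpos sub mv).
  split=> //; apply: (@le_trans _ _ (\int[leb]_(x in `[a, b]) G x)).
    by apply: Rintegral_le => //; exact: integrable_norm.
  rewrite Rintegral_add//; [|exact: integrable_segment_cst|exact: integrable_on_scale].
  rewrite Rintegral_scale// (Rintegral_segment_cst _ (ltW ab)) lerD2l mulrC.
  by rewrite ler_pM2r// invr_gt0 mulr_gt0.
have p0 (x : R) := powR_ge0 x (mu - 1).
split; apply: main => // x ax xb; have := Hm x ax xb => mx.
  have := sqr_ge0 (x * g2 x); have := sqr_ge0 (x * g1 x); have := sqr_ge0 (g x).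
  rewrite /energy => ? ? ?.
  apply: (@le_trans _ _ (x `^ (mu - 1) * g1 x ^+ 2)); last by rewrite ler_wpM2l//; lra.
  rewrite ler_wpM2r ?sqr_ge0// (le_trans _ mx)// /k (ler_piMr (ltW m0))//.
  by rewrite ge_min lexx.
have := sqr_ge0 (g1 x); have := sqr_ge0 (x * g1 x); have := sqr_ge0 (g x).
rewrite /energy => ? ? ?.
apply: (@le_trans _ _ (x `^ (mu - 1) * (x * g2 x) ^+ 2)); last by rewrite ler_wpM2l//; lra.
have x0 := lt_le_trans a0 ax.
rewrite exprMn [leRHS]mulrA ler_wpM2r ?sqr_ge0// ler_pM//; first exact: ltW.
  by rewrite le_min ler01 sqr_ge0.
by rewrite ge_min (ler_pXn2r _ (ltW a0) (ltW x0))// ax orbT.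
Qed.

Lemma energy_closure_L1_segment {R : realType} (mu a b d : R) (f f1 f2 : R -> R) :
  energy_closure mu f f1 f2 -> 0 < a -> a < b -> 0 < d ->
  exists u u1 u2 : R -> R, [/\ C2_derivatives u u1 u2,
    \int[leb]_(x in `[a, b]) `|f1 x - u1 x| <= d &
    \int[leb]_(x in `[a, b]) `|f2 x - u2 x| <= d].
Proof.
move=> [[mf mf1 mf2] iE app] a0 ab d0.
have [m m0 Hm] := Rintegral_segment_energy mu a0 ab.
have ba0 : 0 < b - a by rewrite subr_gt0.
(* Then [h * (b - a)] is d / 2, and an approximant of energy distance at most [m * h * (d / 2)]
   contributes the other half. *)
pose h := d / 2 / (b - a).
have h0 : 0 < h by rewrite !divr_gt0.
have mh : 0 < m * h by rewrite mulr_gt0.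
have [u [u1 [u2 [C2u iu id dh]]]] := app (m * h * (d / 2)) (mulr_gt0 mh (divr_gt0 d0 (ltr0Sn _ 1))).
have [mu0 mu1 mu2] := C2_measurable C2u.
exists u, u1, u2; split=> //.
  have [[_ H] _] := Hm _ _ _ _ h0 (measurable_funB mf1 mu1) (measurable_funB mf2 mu2) id.
  apply: le_trans H _; rewrite /h mulfVK ?gt_eqF// -/h.
  rewrite -ler_pdivrMl// mulrC in dh.
  by apply: le_trans (lerD (lexx _) dh) _; lra.
have [_ [_ H]] := Hm _ _ _ _ h0 (measurable_funB mf1 mu1) (measurable_funB mf2 mu2) id.
apply: le_trans H _; rewrite /h mulfVK ?gt_eqF// -/h.
rewrite -ler_pdivrMl// mulrC in dh.
by apply: le_trans (lerD (lexx _) dh) _; lra.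
Qed.

Lemma Rintegral_segment_sub {R : realType} (F : R -> R) (a x b : R) :
  a <= x -> x <= b -> integrable_on `[a, b] F ->
  \int[leb]_(t in `[a, b]) F t - \int[leb]_(t in `[a, x]) F t =
  \int[leb]_(t in `[x, b]) F t.
Proof.
move=> ax xb iF; rewrite Rintegral_itvB// ?bnd_simp// Rintegral_itv_obnd_cbnd//.
by apply: integrableS iF => //; apply: subset_itv; rewrite bnd_simp.
Qed.

Lemma integrable_subsegment {R : realType} (F : R -> R) (a b x y : R) :
  a <= x -> y <= b -> integrable_on `[a, b] F -> integrable_on `[x, y] F.
Proof.
move=> ax yb; apply: integrable_onS => //.
by apply: subset_itv; rewrite bnd_simp.
Qed.

Lemma Rintegral_subsegment_norm {R : realType} (F : R -> R) (a b x y : R) :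
  a <= x -> y <= b -> integrable_on `[a, b] F ->
  `|\int[leb]_(t in `[x, y]) F t| <= \int[leb]_(t in `[a, b]) `|F t|.
Proof.
move=> ax yb iF; apply: le_trans (normr_Rintegral_le _ _) _ => //.
  exact: integrable_subsegment iF.
by apply: le_Rintegral_norm_subset => //; apply: subset_itv; rewrite bnd_simp.
Qed.

(** The primitive [H] of [h] is uniformly close to linear functions vanishing at a, hence is itself
    of this form; its derivative [h] is then constant in the interior. *)
Lemma locally_constant_of_L1_approx {R : realType} (a b : R) (h : R -> R) : a < b ->
  {within `[a, b], continuous h} ->
  (forall d : R, 0 < d -> exists k, \int[leb]_(x in `[a, b]) `|h x - k| <= d) ->
  forall x y, a < x < b -> a < y < b -> h x = h y.
Proof.
move=> ab ch app.
have ih : integrable_on `[a, b] h.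
  by apply: continuous_compact_integrable => //; exact: segment_compact.
pose H x := \int[leb]_(t in `[a, x]) h t.
have HE x : a <= x -> x <= b -> H x * (b - a) = H b * (x - a).
  move=> ax xb; apply/eqP; rewrite -subr_eq0 -normr_le0; apply/ler_addgt0Pr => d d0.
  have ba : 0 < b - a by rewrite subr_gt0.
  have [k Hk] := app (d / 2 / (b - a)) (divr_gt0 (divr_gt0 d0 (ltr0Sn _ 1)) ba).
  have ik : integrable_on `[a, b] (fun x => h x - k).
    by apply: integrable_on_sub => //; exact: integrable_segment_cst.
  have Hy y : a <= y -> y <= b -> `|H y - k * (y - a)| <= d / 2 / (b - a).
    move=> ay yb; rewrite -(Rintegral_segment_cst k ay) /H -Rintegral_sub//.
    - by apply: le_trans Hk; exact: Rintegral_subsegment_norm ik.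
    - exact: integrable_subsegment ih.
    - exact: integrable_segment_cst.
  (* The contributions of the constant [k] cancel, so [k] may vary with [d]. *)
  have -> : H x * (b - a) - H b * (x - a) =
    (H x - k * (x - a)) * (b - a) - (H b - k * (b - a)) * (x - a) by ring.
  rewrite add0r (le_trans (ler_normB _ _))// !normrM (gtr0_norm ba).
  have xa : 0 <= x - a by rewrite subr_ge0.
  have Hx := Hy x ax xb; have Hb := Hy b (ltW ab) (lexx b).
  rewrite (ger0_norm xa).
  apply: (@le_trans _ _ (d / 2 / (b - a) * (b - a) + d / 2 / (b - a) * (b - a))).
    by rewrite lerD//; [rewrite ler_wpM2r// ltW|rewrite ler_pM// lerD2r].
  by rewrite divfK ?gt_eqF//; lra.
suff hE x : a < x < b -> h x = H b / (b - a) by move=> x y /hE -> /hE ->.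
move=> /andP[ax xb].
have chx : {for x, continuous h}.
  have /(continuous_within_itvP _ ab)[+ _ _] := ch; apply.
  by rewrite in_itv /= ax.
have [dH <-] := continuous_FTC1_closed xb ih ax chx.
have dL : is_derive x 1 (fun y => H b / (b - a) * y + - (H b / (b - a) * a)) (H b / (b - a)).
  exact: is_derive_affine.
have : is_derive x 1 H (H b / (b - a)).
  apply: near_eq_is_derive dL; near=> y.
  have ay : a <= y by near: y; apply: lt_le_nbhsr.
  have yb : y <= b by near: y; apply: lt_le_nbhsl.
  have := HE y ay yb; rewrite -mulrBr.
  move=> /(congr1 (fun z => z / (b - a))); rewrite mulfK ?gt_eqF ?subr_gt0// => ->.
  by ring.
by move=> dHx; rewrite derive1E; case: dHx.
Unshelve. all: by end_near. Qed.

(** For an approximant u, u' minus the integral of u'' from a is the constant u'(a). By L^1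
    convergence on [a, b], f' minus the integral of f'' is approximated by constants, hence
    constant. *)
Lemma energy_closure_primitive {R : realType} (mu : R) (f f1 f2 : R -> R) :
  energy_closure mu f f1 f2 -> (forall x : R, 0 < x -> {for x, continuous f1}) ->
  forall x y : R, 0 < x -> x < y ->
    integrable_on `[x, y] f2 /\ f1 y - f1 x = \int[leb]_(t in `[x, y]) f2 t.
Proof.
move=> cl cf1 x y x0 xy.
(* A wider segment, because constancy is obtained only at interior points. *)
pose a := x / 2; pose b := y + 1.
have a0 : 0 < a by rewrite divr_gt0.
have ax : a < x by rewrite /a; lra.
have yb : y < b by rewrite /b; lra.
have ab : a < b by rewrite (lt_trans ax)// (lt_trans xy).
have [[mf mf1 mf2] iE _] := cl.
have [m m0 /(_ _ _ _ _ ltr01 mf1 mf2 iE)[_ [if2 _]]] := Rintegral_segment_energy mu a0 ab.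
have if1 : integrable_on `[a, b] f1 by exact: integrable_segment.
pose G x := \int[leb]_(t in `[a, x]) f2 t.
have cG : {within `[a, b], continuous G}.
  by have := parameterized_integral_continuous (ltW ab) if2.
pose h x := f1 x - G x.
have ch : {within `[a, b], continuous h}.
  by move=> z; apply: cvgB; [exact: (continuous_Rpos_segment a0 cf1)|exact: cG].
have ih : integrable_on `[a, b] h.
  by apply: continuous_compact_integrable => //; exact: segment_compact.
have hxy : h x = h y.
  apply: (locally_constant_of_L1_approx ab ch); last 2 first.
    by rewrite ax (lt_trans xy).
    by rewrite (lt_trans ax).
  (* The errors in u' and u'' add up to e + e (b - a), which is d for this choice of e. *)
  move=> d d0; have e0 : 0 < d / (b - a + 1).
    by rewrite divr_gt0// addr_gt0// subr_gt0.
  have [u [u1 [u2 [C2u d1 d2]]]] := energy_closure_L1_segment cl a0 ab e0.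
  have cu1 := C2_continuous1 C2u; have cu2 := C2_continuous2 C2u.
  have iu1 : integrable_on `[a, b] u1 by exact: integrable_segment.
  have iu2 : integrable_on `[a, b] u2 by exact: integrable_segment.
  set e := d / _ in d1 d2 e0; exists (u1 a).
  have ifu1 := integrable_on_sub (measurable_set_itv _) if1 iu1.
  have ifu2 := integrable_on_sub (measurable_set_itv _) if2 iu2.
  apply: (@le_trans _ _ (\int[leb]_(x in `[a, b]) (`|f1 x - u1 x| + e))).
    apply: Rintegral_le => //.
    - apply: integrable_norm => //; apply: integrable_on_sub => //.
      exact: integrable_segment_cst.
    - apply: integrable_on_add => //; last exact: integrable_segment_cst.
      exact: integrable_norm.
    - move=> z; rewrite /= in_itv /= => /andP[az zb].
      have -> : h z - u1 a = f1 z - u1 z - (G z - (u1 z - u1 a)) by rewrite /h; ring.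
      rewrite (le_trans (ler_normB _ _))// lerD2l.
      have -> : u1 z - u1 a = \int[leb]_(t in `[a, z]) u2 t.
        move: az; rewrite le_eqVlt => /predU1P[<-|az].
          by rewrite subrr set_itv1 Rintegral_set1.
        have du (w : R) : 0 < w -> is_derive w 1 u1 (u2 w) by move=> /C2u[].
        by rewrite (Rintegral_FTC a0 az du).
      rewrite -Rintegral_sub//; [|exact: integrable_subsegment if2
                                 |exact: integrable_subsegment iu2].
      by apply: le_trans d2; exact: Rintegral_subsegment_norm.
  rewrite Rintegral_add//; [|exact: integrable_norm|exact: integrable_segment_cst].
  rewrite (Rintegral_segment_cst _ (ltW ab)).
  apply: le_trans (lerD d1 (lexx _)) _.
  rewrite -[X in X + _]mulr1 -mulrDr /e addrC divfK//.
  by rewrite gt_eqF// addr_gt0// subr_gt0.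
split; first exact: (integrable_subsegment (ltW ax) (ltW yb) if2).
rewrite -(Rintegral_segment_sub (ltW ax) (ltW xy)); last first.
  exact: (integrable_subsegment (lexx a) (ltW yb) if2).
by rewrite -/(G y) -/(G x); move: hxy; rewrite /h; lra.
Qed.

Lemma Rintegral_eq0_ae {R : realType} (F : R -> R) :
  integrable_on Rpos F -> (forall x : R, 0 < x -> 0 <= F x) ->
  \int[leb]_(x in Rpos) F x = 0 ->
  {ae leb, forall x : R, 0 < x -> F x = 0}.
Proof.
move=> iF F0 I0.
have I0E : (\int[leb]_(x in Rpos) `|(EFin \o F) x| = 0)%E.
  have -> : (\int[leb]_(x in Rpos) `|(EFin \o F) x| = \int[leb]_(x in Rpos) (F x)%:E)%E.
    apply: eq_integral => x; rewrite mem_Rpos => x0 /=.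
    by rewrite ger0_norm// F0.
  have fin : (\int[leb]_(x in Rpos) (F x)%:E)%E \is a fin_num.
    by apply: integrable_fin_num => //; exact: measurable_Rpos.
  by rewrite -(fineK fin); move: I0; rewrite /Rintegral => ->.
have mF : measurable_fun Rpos (EFin \o F) by exact: measurable_int iF.
have : ae_eq leb Rpos (EFin \o F) (cst 0%E).
  by apply/ae_eq_integral_abs => //; exact: measurable_Rpos.
apply: filterS => x + x0; rewrite RposE => /(_ x0) [].
by move=> ->.
Qed.

Lemma ae_eq_Rintegral_Rpos {R : realType} (A : set R) (F G : R -> R) :
  measurable A -> A `<=` Rpos -> measurable_fun Rpos F -> measurable_fun Rpos G ->
  {ae leb, forall x : R, 0 < x -> F x = G x} ->
  \int[leb]_(x in A) F x = \int[leb]_(x in A) G x.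
Proof.
move=> mA AR mF mG FG; congr fine; apply: ae_eq_integral.
- exact: mA.
- by apply/measurable_EFinP; exact: (measurable_funS measurable_Rpos AR mF).
- by apply/measurable_EFinP; exact: (measurable_funS measurable_Rpos AR mG).
- apply: filterS FG; first exact: (ae_filter_ringOfSetsType leb).
  by move=> x FGx /AR; rewrite RposE => /FGx /= ->.
Qed.

(** Lebesgue differentiation: almost everywhere F is the derivative of its primitive, which is
    locally zero. *)
Lemma Rintegral_segments_eq0_ae {R : realType} (F : R -> R) :
  (forall a b : R, 0 < a -> a < b ->
     integrable_on `[a, b] F /\ \int[leb]_(x in `[a, b]) F x = 0) ->
  {ae leb, forall x : R, 0 < x -> F x = 0}.
Proof.
move=> HF.
have loc (p q : R) : 0 < p -> p < q -> {ae leb, forall x : R, p < x < q -> F x = 0}.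
  move=> p0 pq; have [iF _] := HF p q p0 pq.
  (* Extension by zero gives a function integrable on the whole line, to which the differentiation
     theorem applies. *)
  pose G := F \_ `[p, q].
  have iG : integrable_on setT G.
    by rewrite /G -restrict_EFin; apply/integrable_restrict => //=; rewrite setTI.
  have lG : locally_integrable setT G by apply: open_integrable_locally => //; exact: openT.
  have iGy (y : R) : integrable_on [set` Interval (BLeft p) (BRight y)] G.
    exact: (integrable_onS _ _ _ iG).
  have := FTC1 iGy lG; apply: filterS; first exact: (ae_filter_ringOfSetsType leb).
  move=> x + /andP[px xq].
  rewrite lte_fin => /(_ px) [_].
  have dc : is_derive x 1 (cst 0 : R -> R) 0 by exact: is_derive_cst.
  have : is_derive x 1 (fun y => \int[leb]_(t in [set` Interval (BLeft p) (BRight y)]) G t) 0.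
    apply: near_eq_is_derive dc; near=> y.
    have py : p < y by near: y; apply: lt_nbhsr.
    have yq : y < q by near: y; apply: lt_nbhsl.
    rewrite -[LHS](HF p y p0 py).2; apply: eq_Rintegral => t.
    rewrite inE /= in_itv /= => /andP[pt ty].
    by rewrite /G patchE mem_set//= in_itv /= pt (le_trans ty)// ltW.
  move=> [_ dE]; rewrite derive1E dE => /esym.
  by rewrite /G patchE mem_set//= in_itv /= !ltW.
(* Countably many intervals cover (0, +oo); the index n + 2 makes even the first one nonempty. *)
have key n : {ae leb, forall x : R, n.+2%:R^-1 < x < n.+2%:R -> F x = 0}.
  apply: loc; first by rewrite invr_gt0.
  by rewrite invf_plt ?posrE// (lt_trans (_ : _ < 1)) ?invf_lt1 ?ltr1n.
have : {ae leb, forall x : R, forall n, n.+2%:R^-1 < x < n.+2%:R -> F x = 0}.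
  by apply/ae_foralln => n; exact: key.
apply: filterS; first exact: (ae_filter_ringOfSetsType leb).
move=> x Hx x0.
pose n := Num.truncn (Num.max x x^-1).
have : Num.max x x^-1 < n.+2%:R.
  by apply: lt_le_trans (truncnS_gt _) _; rewrite ler_nat leqW.
rewrite gt_max => /andP[xn xin]; apply: (Hx n).
by rewrite xn andbT invf_plt// posrE.
Unshelve. all: by end_near. Qed.

(** Upgrades regularity: when f'' has a continuous version [phi], f' is classically
    differentiable. *)
Lemma continuous_primitive_derive {R : realType} (f1 phi : R -> R) :
  (forall x : R, 0 < x -> {for x, continuous phi}) ->
  (forall x y : R, 0 < x -> x < y -> f1 y - f1 x = \int[leb]_(t in `[x, y]) phi t) ->
  forall x : R, 0 < x -> is_derive x 1 f1 (phi x).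
Proof.
move=> cphi Hf x x0; pose a := x / 2.
have a0 : 0 < a by rewrite divr_gt0.
have ax : a < x by rewrite /a; lra.
have iphi : integrable_on `[a, x + 1] phi by exact: integrable_segment.
have x1 : x < x + 1 by rewrite ltrDl.
have [dF FE] := continuous_FTC1_closed x1 iphi ax (cphi x x0).
have dF' : is_derive x 1 (fun y => \int[leb]_(t in `[a, y]) phi t + f1 a) (phi x + 0).
  have dF1 : is_derive x 1 (fun y => \int[leb]_(t in `[a, y]) phi t) (phi x).
    by apply: DeriveDef => //; rewrite -derive1E.
  exact: is_derive_addf dF1 (is_derive_cst (f1 a) x 1).
rewrite addr0 in dF'; apply: near_eq_is_derive dF'; near=> y.
have ay : a < y by near: y; apply: lt_nbhsr.
by rewrite -(Hf a y a0 ay) subrK.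
Unshelve. all: by end_near. Qed.

(** * Kummer's function *)

(** Domination by the coefficients of C exp(M x): this implies convergence everywhere and is stable
    under termwise differentiation, so it can be used repeatedly. *)
Definition exp_bounded {R : realType} (a : R^nat) : Prop :=
  exists C M : R, [/\ 0 <= C, 0 <= M & forall k, `|a k| <= C * (M ^+ k / k`!%:R)].

Lemma exp_bounded_diffs {R : realType} (a : R^nat) :
  exp_bounded a -> exp_bounded (pseries_diffs a).
Proof.
move=> [C [M [C0 M0 aM]]]; exists (C * M), M; split=> //; first exact: mulr_ge0.
move=> k; rewrite /pseries_diffs normrM normr_nat.
apply: le_trans (ler_wpM2l _ (aM k.+1)) _ => //.
have s0 : k`!%:R != 0 :> R by rewrite pnatr_eq0 -lt0n fact_gt0.
have t0 : k.+1%:R != 0 :> R by rewrite pnatr_eq0.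
rewrite factS natrM exprS; move: s0 t0; set t := k.+1%:R; set s := k`!%:R => s0 t0.
rewrite le_eqVlt; apply/orP; left; apply/eqP; field.
by rewrite -/s s0 addrC natr1.
Qed.

Lemma exp_bounded_cvg {R : realType} (a : R^nat) (x : R) :
  exp_bounded a -> cvgn (pseries a x).
Proof.
move=> [C [M [C0 M0 aM]]]; apply: normed_cvg.
apply: (@series_le_cvg _ _ (fun k => C * exp_coeff (M * `|x|) k)) => //.
- by move=> k /=; exact: normr_ge0.
- by move=> k /=; apply: mulr_ge0 => //; apply: exp_coeff_ge0; exact: mulr_ge0.
- move=> k /=; rewrite normrM normrX /exp_coeff /= exprMn.
  have -> : C * (M ^+ k * `|x| ^+ k / k`!%:R) = C * (M ^+ k / k`!%:R) * `|x| ^+ k by ring.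
  by rewrite ler_wpM2r ?exprn_ge0.
- by apply: is_cvg_seriesZ; exact: is_cvg_series_exp_coeff.
Qed.

Lemma exp_bounded_derive {R : realType} (a : R^nat) (x : R) : exp_bounded a ->
  is_derive x 1 (fun y => limn (pseries a y)) (limn (pseries (pseries_diffs a) x)).
Proof.
move=> ea; have eda := exp_bounded_diffs ea.
apply: (@pseries_snd_diffs _ _ (`|x| + 1)); try exact: exp_bounded_cvg.
  exact/exp_bounded_cvg/exp_bounded_diffs.
by rewrite [ltRHS]ger0_norm ?addr_ge0// ltrDl.
Qed.

Definition kummer_coeff {R : realType} (b mu : R) (k : nat) : R :=
  (\prod_(0 <= i < k) (b + i%:R)) / (\prod_(0 <= i < k) (mu + i%:R)) / k`!%:R.

Lemma kummer_coeff0 {R : realType} (b mu : R) : kummer_coeff b mu 0 = 1.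
Proof. by rewrite /kummer_coeff !big_nil fact0 !divr1. Qed.

Lemma kummer_coeffS {R : realType} (b mu : R) (k : nat) : 0 < mu ->
  k.+1%:R * (mu + k%:R) * kummer_coeff b mu k.+1 = (b + k%:R) * kummer_coeff b mu k.
Proof.
move=> mu0; rewrite /kummer_coeff !big_nat_recr //= factS natrM.
have : \prod_(0 <= i < k) (mu + i%:R) != 0.
  by rewrite prodf_seq_neq0; apply/allP => i _ /=; rewrite gt_eqF// ltr_pwDl.
set P := \prod_(_ <= _ < _) _; set Q := \prod_(_ <= _ < _) _ => Q0.
have F0 : k`!%:R != 0 :> R by rewrite pnatr_eq0 -lt0n fact_gt0.
have m0 : mu + k%:R != 0 by rewrite gt_eqF// ltr_pwDl.
have k0 : k.+1%:R != 0 :> R by rewrite pnatr_eq0.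
field; by rewrite Q0 F0 m0 /= [1 + _]addrC natr1 k0.
Qed.

(** Each ratio |b + k| / (mu + k) is at most M = |b| / mu + 1, since M (mu + k) >= |b| + k. *)
Lemma kummer_coeff_exp_bounded {R : realType} (b mu : R) : 0 < mu ->
  exp_bounded (kummer_coeff b mu).
Proof.
move=> mu0; exists 1, (`|b| / mu + 1).
have M0 : 0 <= `|b| / mu + 1 by rewrite addr_ge0// divr_ge0// ltW.
split=> // k; rewrite mul1r /kummer_coeff normrM normfV normr_nat.
rewrite ler_wpM2r ?invr_ge0//.
elim: k => [|k IH]; first by rewrite !big_nil expr0 divr1 normr1.
rewrite !big_nat_recr //= invfM mulrACA normrM exprSr ler_pM//.
have m0 : 0 < mu + k%:R by rewrite ltr_pwDl.
rewrite normrM normfV (gtr0_norm m0) ler_pdivrMr//.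
apply: (@le_trans _ _ (`|b| + k%:R)).
  by rewrite (le_trans (ler_normD _ _))// normr_nat.
rewrite mulrDl mul1r mulrDr divfK ?gt_eqF// -addrA lerD2l.
have H : 0 <= `|b| / mu * k%:R by rewrite mulr_ge0// divr_ge0// ltW.
by rewrite addrA lerDr addr_ge0// ltW.
Qed.

Lemma kummerE {R : realType} (b mu x : R) : 0 < mu ->
  kummer b mu x = limn (pseries (kummer_coeff b mu) x).
Proof.
move=> mu0; rewrite /kummer.
set u := (fun n => _).
have cv := exp_bounded_cvg (x := x) (kummer_coeff_exp_bounded b mu0).
(* The shift to n + 1 matters: the empty power sum is 0 and lacks the constant term 1. *)
have E n : pseries (kummer_coeff b mu) x n.+1 = 1 + u n.+1.
  rewrite /pseries /series /= big_nat_recl// kummer_coeff0 expr0 mulr1.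
  by rewrite /u big_add1 /=; congr (_ + _); apply: eq_bigr => i _; rewrite /kummer_coeff; ring.
have cu : u @ \oo --> limn (pseries (kummer_coeff b mu) x) - 1.
  rewrite -cvg_shiftS.
  have -> : (fun n => u n.+1) = (fun n => pseries (kummer_coeff b mu) x n.+1 - 1).
    by apply/funext => n; rewrite E; ring.
  by apply: cvgB; [rewrite cvg_shiftS|exact: cvg_cst].
by rewrite (cvg_lim _ cu)//; ring.
Qed.

Definition kummer1 {R : realType} (b mu x : R) : R :=
  limn (pseries (pseries_diffs (kummer_coeff b mu)) x).
Definition kummer2 {R : realType} (b mu x : R) : R :=
  limn (pseries (pseries_diffs (pseries_diffs (kummer_coeff b mu))) x).

Section kummer_ode.
Context {R : realType} (b mu : R) (mu0 : 0 < mu).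
Let a := kummer_coeff b mu.
Let ea : exp_bounded a := kummer_coeff_exp_bounded b mu0.

Lemma is_derive_kummer (x : R) : is_derive x 1 (kummer b mu) (kummer1 b mu x).
Proof.
have -> : kummer b mu = (fun y => limn (pseries a y)).
  by apply/funext => y; exact: kummerE.
exact: exp_bounded_derive.
Qed.

Lemma is_derive_kummer1 (x : R) : is_derive x 1 (kummer1 b mu) (kummer2 b mu x).
Proof. exact/exp_bounded_derive/exp_bounded_diffs. Qed.

Lemma kummer_at0 : kummer b mu 0 = 1.
Proof.
rewrite kummerE//; apply/cvg_lim => //; rewrite -cvg_shiftS.
rewrite (_ : (fun n => _) = cst 1); first exact: cvg_cst.
apply/funext => n; rewrite /pseries /series /= big_nat_recl// kummer_coeff0 expr0 mulr1.
by rewrite big1 ?addr0// => i _; rewrite expr0n mulr0.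
Qed.

(** The left-hand side is the limit of the same expression [P] in the partial sums, which has a
    closed form tending to 0. *)
Lemma kummer_ode (x : R) :
  x * kummer2 b mu x + (mu - x) * kummer1 b mu x - b * kummer b mu x = 0.
Proof.
have eda := exp_bounded_diffs ea; have edda := exp_bounded_diffs eda.
have c0 := exp_bounded_cvg (x := x) ea; have c1 := exp_bounded_cvg (x := x) eda.
have c2 := exp_bounded_cvg (x := x) edda.
rewrite kummerE// /kummer1 /kummer2.
pose P n := x * pseries (pseries_diffs (pseries_diffs a)) x n
  + (mu - x) * pseries (pseries_diffs a) x n - b * pseries a x n.
have Pcv : P @ \oo --> x * limn (pseries (pseries_diffs (pseries_diffs a)) x)
  + (mu - x) * limn (pseries (pseries_diffs a) x) - b * limn (pseries a x).
  by apply: cvgB; [apply: cvgD|]; apply: cvgM => //; exact: cvg_cst.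
(* the partial sums telescope thanks to the recurrence on the coefficients *)
have PE n : P n = n%:R * (n.+1%:R * a n.+1 - a n) * x ^+ n.
  elim: n => [|n IH].
    by rewrite /P /pseries /series /= !big_geq//; ring.
  have -> : P n.+1 = P n + (x * (pseries_diffs (pseries_diffs a) n * x ^+ n)
     + (mu - x) * (pseries_diffs a n * x ^+ n) - b * (a n * x ^+ n)).
    by rewrite /P /pseries /series /= !big_nat_recr//=; ring.
  have := kummer_coeffS b n mu0; rewrite -/a IH /pseries_diffs exprS => H.
  have -> : b * (a n * x ^+ n) =
    (n.+1%:R * (mu + n%:R) * a n.+1 - n%:R * a n) * x ^+ n.
    by rewrite H; ring.
  by rewrite -(natr1 n.+1) -(natr1 n); ring.
(* [P n.+1] is x times the difference of the general terms of two convergent series. *)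
have E0 : (fun n => P n.+1) @ \oo --> (x * (0 - 0) : R).
  have -> : (fun n => P n.+1) = (fun n => x * (pseries_diffs (pseries_diffs a) n * x ^+ n
      - pseries_diffs a n * x ^+ n)).
    by apply/funext => n; rewrite PE /pseries_diffs exprS; ring.
  apply: cvgM; first exact: cvg_cst.
  by apply: cvgB; exact: cvg_series_cvg_0.
rewrite cvg_shiftS subr0 mulr0 in E0.
by rewrite -(cvg_lim _ Pcv)// (cvg_lim _ E0).
Qed.

End kummer_ode.

(** * Uniqueness for the ordinary differential equation *)

Section kummer_solution.
Context {R : realType} (mu c l : R).
Context (mu0 : 0 < mu).

(** Here [mu - c] is b. With [2 - mu] and [1 - mu + c] in place of [mu] and [c], this first
    parameter becomes 1 - c, that is b + 1 - mu, as the case mu < 0 requires. *)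
Definition kummer_decay (x : R) : R := expR (- (l * x)) * kummer (mu - c) mu (l * x).

Definition kummer_decay1 (x : R) : R :=
  l * expR (- (l * x)) * (kummer1 (mu - c) mu (l * x) - kummer (mu - c) mu (l * x)).

Definition kummer_decay2 (x : R) : R :=
  l ^+ 2 * expR (- (l * x)) * (kummer2 (mu - c) mu (l * x)
    - 2 * kummer1 (mu - c) mu (l * x) + kummer (mu - c) mu (l * x)).

Let dl (x : R) : is_derive x 1 (fun y => l * y) l.
Proof.
by apply: is_derive_eq (is_derive_scalef l (is_derive_id x 1)) _; rewrite mulr1.
Qed.

Let dexp (x : R) : is_derive x 1 (fun y => expR (- (l * y))) (- l * expR (- (l * x))).
Proof.
have dN : is_derive x 1 (fun y => - (l * y)) (- l) by exact: is_deriveN.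
by apply: is_derive_eq (is_derive1_comp (is_derive_expR _) dN) _; rewrite mulrC.
Qed.

Lemma is_derive_kummer_decay (x : R) : is_derive x 1 kummer_decay (kummer_decay1 x).
Proof.
have d0 := is_derive1_comp (is_derive_kummer (mu - c) mu0 (l * x)) (dl x).
apply: is_derive_eq (is_derive_mulf (dexp x) d0) _.
by rewrite /kummer_decay1 /=; ring.
Qed.

Lemma is_derive_kummer_decay1 (x : R) : is_derive x 1 kummer_decay1 (kummer_decay2 x).
Proof.
have d0 := is_derive1_comp (is_derive_kummer (mu - c) mu0 (l * x)) (dl x).
have d1 := is_derive1_comp (is_derive_kummer1 (mu - c) mu0 (l * x)) (dl x).
have dB := is_derive_addf d1 (is_derive_scalef (-1) d0).
have d := is_derive_mulf (is_derive_scalef l (dexp x)) dB.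
have -> : kummer_decay1 = (fun y => l * expR (- (l * y)) *
   ((kummer1 (mu - c) mu \o *%R l) y + -1 * (kummer (mu - c) mu \o *%R l) y)).
  by apply/funext => y; rewrite /kummer_decay1 /= mulN1r.
by apply: is_derive_eq d _; rewrite /kummer_decay2 /=; ring.
Qed.

(** The operator gives l exp(- l x) times Kummer's equation at l x. *)
Lemma kummer_decay_ode (x : R) :
  kummer_op mu c l kummer_decay kummer_decay1 kummer_decay2 x = 0.
Proof.
have := kummer_ode (mu - c) mu0 (l * x).
rewrite /kummer_op /kummer_decay /kummer_decay1 /kummer_decay2.
set K := kummer _ _ _; set K1 := kummer1 _ _ _; set K2 := kummer2 _ _ _ => H.
transitivity (l * expR (- (l * x)) *
  (l * x * K2 + (mu - l * x) * K1 - (mu - c) * K)); first by ring.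
by rewrite H mulr0.
Qed.

Lemma kummer_decay_at0 : kummer_decay 0 = 1.
Proof. by rewrite /kummer_decay mulr0 oppr0 expR0 mul1r kummer_at0. Qed.

Lemma kummer_decay_neq0 : exists2 x : R, 0 < x & kummer_decay x != 0.
Proof.
have cw : {for 0, continuous kummer_decay}.
  exact: is_derive_continuous (is_derive_kummer_decay 0).
have w0 : 0 < kummer_decay 0 by rewrite kummer_decay_at0.
have : \forall x \near (0 : R), 0 < kummer_decay x by exact: (cvgr_gt _ cw _ w0).
move=> /nbhs_ballP[e /= e0 He].
exists (e / 2); first by rewrite divr_gt0.
rewrite gt_eqF//; apply: He; rewrite /ball /= sub0r normrN gtr0_norm ?divr_gt0//.
by rewrite ltr_pdivrMr// mulr_natr mulr2n ltrDl.
Qed.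

Lemma kummer_decay_bound : exists2 C : R, 0 <= C & forall x, 0 < x -> x < 1 ->
  `|kummer_decay x| <= C /\ `|kummer_decay1 x| <= C.
Proof.
have bnd (w : R -> R) : (forall x, {for x, continuous w}) ->
    exists2 C : R, 0 <= C & forall x, 0 < x -> x < 1 -> `|w x| <= C.
  move=> cw; have cn : {within `[0, 1], continuous (fun x => `|w x|)}.
    by apply: continuous_subspaceT => x; apply: cvg_norm; exact: cw.
  have [z _ Hz] := EVT_max ler01 cn.
  exists `|w z| => // x x0 x1; apply: Hz.
  by rewrite in_itv /= !ltW.
have [C C0 HC] := bnd _ (fun x => is_derive_continuous (is_derive_kummer_decay x)).
have [D D0 HD] := bnd _ (fun x => is_derive_continuous (is_derive_kummer_decay1 x)).
exists (C + D); first exact: addr_ge0.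
move=> x x0 x1; split; first by rewrite (le_trans (HC x x0 x1))// lerDl.
by rewrite (le_trans (HD x x0 x1))// lerDr.
Qed.

End kummer_solution.

Section kummer_op_uniqueness.
Context {R : realType} (mu c l : R).

Definition kummer_sol (h h1 h2 : R -> R) : Prop :=
  C2_derivatives h h1 h2 /\ forall x : R, 0 < x -> kummer_op mu c l h h1 h2 x = 0.

(** A Gronwall argument on E = h^2 + h'^2, which satisfies |E'| <= K E away from 0. *)
Lemma kummer_sol_unique (h h1 h2 : R -> R) (x0 : R) :
  kummer_sol h h1 h2 -> 0 < x0 -> h x0 = 0 -> h1 x0 = 0 ->
  forall x : R, 0 < x -> h x = 0.
Proof.
move=> [C2h hop] x00 hx0 h1x0 x xpos.
(* The coefficients mu / y and l c / y are bounded on [p, +oo), which contains both points. *)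
pose p := Num.min x0 x.
have p0 : 0 < p by rewrite lt_min x00.
pose K := 1 + 2 * (`|l| + `|mu| / p) + `|l * c| / p.
pose E y := h y ^+ 2 + h1 y ^+ 2.
pose E1 y := 2 * h y * h1 y + 2 * h1 y * h2 y.
have dE (y : R) : 0 < y -> is_derive y 1 E (E1 y).
  by move=> /C2h[dh dh1 _]; exact: is_derive_addf (is_derive_sqrf dh) (is_derive_sqrf dh1).
have E0 y : 0 <= E y by rewrite addr_ge0 ?sqr_ge0.
have E1K y : p <= y -> `|E1 y| <= K * E y.
  move=> py; have y0 := lt_le_trans p0 py.
  have H2 : h2 y = - ((l + mu / y) * h1 y + l * c / y * h y).
    apply: (mulfI (lt0r_neq0 y0)); apply/eqP; rewrite -subr_eq0; apply/eqP.
    rewrite -[RHS](hop y y0) /kummer_op; field; exact: lt0r_neq0.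
  have AM : 2 * `|h y * h1 y| <= E y.
    rewrite /E normrM -[h y ^+ 2]real_normK ?num_real// -[h1 y ^+ 2]real_normK ?num_real//.
    have := sqr_ge0 (`|h y| - `|h1 y|); nra.
  have ip : y^-1 <= p^-1 by rewrite lef_pV2.
  have -> : E1 y = 2 * (h y * h1 y) + (- (2 * (l + mu / y))) * h1 y ^+ 2
      + (- (l * c / y)) * (2 * (h y * h1 y)).
    by rewrite /E1 H2; ring.
  have -> : K * E y = E y + 2 * (`|l| + `|mu| / p) * E y + `|l * c| / p * E y.
    by rewrite /K; ring.
  apply: le_trans (ler_normD _ _) _; apply: lerD.
    apply: le_trans (ler_normD _ _) _; apply: lerD.
      by rewrite normrM normr_nat.
    rewrite normrM normrN normrM normr_nat [`|h1 y ^+ 2|]ger0_norm ?sqr_ge0//.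
    apply: ler_pM => //; rewrite ?sqr_ge0 ?mulr_ge0//.
      rewrite ler_wpM2l// (le_trans (ler_normD _ _))// lerD2l normrM normfV (gtr0_norm y0).
      by rewrite ler_wpM2l.
    by rewrite /E lerDr sqr_ge0.
  rewrite normrM normrN normrM [`|2 * _|]normrM normr_nat.
  apply: ler_pM => //; rewrite ?mulr_ge0//.
  by rewrite normfV (gtr0_norm y0) ler_wpM2l.
have dl (k y : R) : is_derive y 1 (fun z => k * z) k.
  by apply: is_derive_eq (is_derive_scalef k (is_derive_id y 1)) _; rewrite mulr1.
have dG (k y : R) : 0 < y ->
    is_derive y 1 (fun z => E z * expR (k * z)) ((E1 y + k * E y) * expR (k * y)).
  move=> y0; have de := is_derive1_comp (is_derive_expR (k * y)) (dl k y).
  by apply: is_derive_eq (is_derive_mulf (dE y y0) de) _; rewrite /=; ring.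
have Ex0 : E x0 = 0 by rewrite /E hx0 h1x0; ring.
suff Ex : E x <= 0.
  apply/eqP; rewrite -sqrf_eq0 eq_le sqr_ge0 andbT (le_trans _ Ex)//.
  by rewrite /E lerDl sqr_ge0.
have cG (k a b : R) : 0 < a -> {within `[a, b], continuous (fun z => E z * expR (k * z))}.
  by move=> a0; apply: continuous_Rpos_segment => // y y0; exact: is_derive_continuous (dG k y y0).
(* To the left of [x0], E exp(K y) is nondecreasing; to the right, E exp(- K y) is nonincreasing. *)
have [xx0|x0x] := leP x x0.
- have px : p = x by rewrite /p; apply/min_idPr.
  have : E x * expR (K * x) <= E x0 * expR (K * x0).
    apply: (@ger0_derive1_le_cc R (fun z => E z * expR (K * z)) x x0).
    + move=> y; rewrite in_itv /= => /andP[xy _].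
      exact: (@ex_derive _ _ _ _ _ _ _ (dG K y (lt_trans xpos xy))).
    + move=> y; rewrite in_itv /= => /andP[xy _].
      rewrite derive1E; have [_ ->] := dG K y (lt_trans xpos xy).
      rewrite mulr_ge0 ?expR_ge0//.
      have := E1K y; rewrite px => /(_ (ltW xy)); rewrite ler_norml; lra.
    + exact: cG.
    + by rewrite in_itv /= lexx.
    + by rewrite in_itv /= lexx andbT.
    + exact: xx0.
  by rewrite Ex0 mul0r pmulr_lle0// expR_gt0.
- have px : p = x0 by rewrite /p; apply/min_idPl; exact: ltW.
  have : E x * expR (- K * x) <= E x0 * expR (- K * x0).
    apply: (@ler0_derive1_nincr R (fun z => E z * expR (- K * z)) x0 x) => //.
    + move=> y; rewrite in_itv /= => /andP[xy _].
      exact: (@ex_derive _ _ _ _ _ _ _ (dG (- K) y (lt_trans x00 xy))).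
    + move=> y; rewrite in_itv /= => /andP[xy _].
      rewrite derive1E; have [_ ->] := dG (- K) y (lt_trans x00 xy).
      rewrite mulr_le0_ge0 ?expR_ge0//.
      have := E1K y; rewrite px => /(_ (ltW xy)); rewrite ler_norml; lra.
    + exact: cG.
    + exact: ltW.
  by rewrite Ex0 mul0r pmulr_lle0// expR_gt0.
Qed.

End kummer_op_uniqueness.

(* The bound by [x `^ nu] excludes the second solution, which has infinite energy
   near [0]. *)
Definition regular_sol {R : realType} (mu c l : R) (g g1 g2 : R -> R) : Prop :=
  [/\ kummer_sol mu c l g g1 g2,
      exists nu C : R, [/\ 0 < mu + 2 * nu, 0 <= C & forall x, 0 < x -> x < 1 ->
        `|g x| <= C * x `^ nu /\ `|g1 x| <= C * x `^ nu] &
      exists2 x : R, 0 < x & g x != 0].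

Lemma regular_sol_pos {R : realType} (mu c l : R) : 0 < mu ->
  regular_sol mu c l (kummer_decay mu c l) (kummer_decay1 mu c l) (kummer_decay2 mu c l).
Proof.
move=> mu0; split.
- split; last by move=> x _; exact: kummer_decay_ode.
  move=> x x0; split; [exact: is_derive_kummer_decay|exact: is_derive_kummer_decay1|].
  (* Continuity of the second derivative is read off the equation solved for it. *)
  pose phi y := - ((l * y + mu) * kummer_decay1 mu c l y + l * c * kummer_decay mu c l y) / y.
  have cphi : {for x, continuous phi}.
    have cw := is_derive_continuous (is_derive_kummer_decay c l mu0 x).
    have cw1 := is_derive_continuous (is_derive_kummer_decay1 c l mu0 x).
    have cl := is_derive_continuous (is_derive_affine l mu x).
    apply: cvgM; last by apply: cvgV; [rewrite gt_eqF|exact: cvg_id].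
    by apply: cvgN; apply: cvgD; apply: cvgM => //; exact: cvg_cst.
  have E : {near x, phi =1 kummer_decay2 mu c l}.
    near=> y; have y0 : 0 < y by near: y; exact: lt_nbhsr.
    apply: (mulfI (lt0r_neq0 y0)); apply/eqP; rewrite -subr_eq0; apply/eqP.
    rewrite /phi -[RHS]oppr0 -[in RHS](kummer_decay_ode c l mu0 y) /kummer_op.
    by field; exact: lt0r_neq0.
  rewrite /continuous_at /prop_for -(nbhs_singleton E).
  by apply: cvg_trans cphi; apply: near_eq_cvg; exact: E.
- have [C C0 HC] := kummer_decay_bound c l mu0.
  exists 0, C; rewrite mulr0 addr0; split=> // x x0 x1.
  by rewrite powRr0 mulr1; exact: HC.
- exact: kummer_decay_neq0.
Unshelve. all: by end_near. Qed.

(** x^(1-mu) w satisfies the equation with parameters mu, c when w satisfies the one with 2 - mu, 1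
    - mu + c, which falls under the positive case. *)
Lemma regular_sol_neg {R : realType} (mu c l : R) : mu < 0 -> 0 < l ->
  exists g1 g2, regular_sol mu c l
    (fun x => (l * x) `^ (1 - mu) * kummer_decay (2 - mu) (1 - mu + c) l x) g1 g2.
Proof.
move=> mu0 l0; have m0 : 0 < 2 - mu by lra.
have [[C2w wop] _ [z z0 wz]] := @regular_sol_pos R (2 - mu) (1 - mu + c) l m0.
have [C C0 HC] := kummer_decay_bound (1 - mu + c) l m0.
set w := kummer_decay _ _ _ in C2w wop HC wz *.
set w1 := kummer_decay1 _ _ _ in C2w wop HC *.
set w2 := kummer_decay2 _ _ _ in C2w wop *.
pose L := l `^ (1 - mu).
have L0 : 0 < L by exact: powR_gt0.
pose g x := L * (x `^ (1 - mu) * w x).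
pose g1 x := L * ((1 - mu) * (x `^ (- mu) * w x) + x `^ (1 - mu) * w1 x).
pose g2 x := L * ((1 - mu) * (- mu * (x `^ (- mu - 1) * w x) + 2 * (x `^ (- mu) * w1 x))
   + x `^ (1 - mu) * w2 x).
have dp (p x : R) : 0 < x -> is_derive x 1 (fun y => y `^ p) (p * x `^ (p - 1)).
  by move=> x0; exact: is_derive1_powR.
have e1 : 1 - mu - 1 = - mu by ring.
have gE (x : R) : 0 < x -> (l * x) `^ (1 - mu) * w x = g x.
  by move=> x0; rewrite /g powRM ?ltW// mulrA.
have dg (x : R) : 0 < x -> is_derive x 1 g (g1 x).
  move=> x0; have [dw dw1 _] := C2w x x0.
  apply: is_derive_eq (is_derive_scalef L (is_derive_mulf (dp (1 - mu) x x0) dw)) _.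
  by rewrite e1 /g1; ring.
have dg1 (x : R) : 0 < x -> is_derive x 1 g1 (g2 x).
  move=> x0; have [dw dw1 _] := C2w x x0.
  apply: is_derive_eq (is_derive_scalef L (is_derive_addf
    (is_derive_scalef (1 - mu) (is_derive_mulf (dp (- mu) x x0) dw))
    (is_derive_mulf (dp (1 - mu) x x0) dw1))) _.
  by rewrite e1 /g2; ring.
have cg2 (x : R) : 0 < x -> {for x, continuous g2}.
  move=> x0; have [dw dw1 cw2] := C2w x x0.
  have cw := is_derive_continuous dw; have cw1 := is_derive_continuous dw1.
  have cp p := is_derive_continuous (dp p x x0).
  apply: cvgM; first exact: cvg_cst.
  apply: cvgD; last by apply: cvgM => //; exact: cp.
  apply: cvgM; first exact: cvg_cst.
  apply: cvgD; (apply: cvgM; first exact: cvg_cst); apply: cvgM => //; exact: cp.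
exists g1, g2; split.
- split.
    move=> x x0; split; [|exact: dg1|exact: cg2].
    apply: near_eq_is_derive (dg x x0); near=> y.
    by rewrite gE//; near: y; exact: lt_nbhsr.
  move=> x x0; have := wop x x0; rewrite /kummer_op gE// /g /g1 /g2.
  rewrite (powR_succ (1 - mu) x0) e1 (powR_succ (- mu) x0) => H.
  transitivity (L * x `^ (- mu - 1) * x ^+ 2 * (x * w2 x + (l * x + (2 - mu)) * w1 x
     + l * (1 - mu + c) * w x)); first by ring.
  by rewrite H mulr0.
(* The derivative is of order x^(-mu), the function even smaller on (0, 1); with nu = - mu, the
   quantity mu + 2 nu is - mu > 0. *)
- exists (- mu), (L * (C + (1 - mu) * C)).
  have mu1 : 0 <= 1 - mu by lra.
  split; first by lra.
    by rewrite mulr_ge0 ?addr_ge0 ?mulr_ge0// ltW.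
  move=> x x0 x1; have [wC w1C] := HC x x0 x1.
  have p0 := powR_ge0 x (- mu).
  have px : x `^ (1 - mu) <= x `^ (- mu).
    by rewrite (powR_succ (1 - mu) x0) e1 ler_piMr// ltW.
  have A : `|x `^ (1 - mu) * w x| <= C * x `^ (- mu).
    by rewrite normrM (ger0_norm (powR_ge0 _ _)) mulrC ler_pM// powR_ge0.
  have B : `|x `^ (1 - mu) * w1 x| <= C * x `^ (- mu).
    by rewrite normrM (ger0_norm (powR_ge0 _ _)) mulrC ler_pM// powR_ge0.
  have D : `|x `^ (- mu) * w x| <= C * x `^ (- mu).
    by rewrite normrM (ger0_norm (powR_ge0 _ _)) mulrC ler_wpM2r.
  rewrite gE// /g /g1 -mulrA !(normrM L) (gtr0_norm L0) !(ler_pM2l L0); split.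
    rewrite (le_trans A)// [leRHS]mulrDl lerDl mulr_ge0 ?mulr_ge0//.
  rewrite [leRHS]mulrDl [leRHS]addrC -[X in _ <= X + _]mulrA (le_trans (ler_normD _ _))// lerD//.
  by rewrite normrM (ger0_norm mu1) ler_wpM2l.
- exists z => //; rewrite mulf_neq0// gt_eqF// powR_gt0// mulr_gt0//.
Unshelve. all: by end_near. Qed.

(** * Wronskian and uniqueness of the regular solution *)

Section wronskian.
Context {R : realType} (mu c l : R).

(** Abel's identity: x^mu exp(l x) is the integrating factor of the first-order coefficient l + mu /
    x. *)
Lemma wronskian_cst (f f1 f2 g g1 g2 : R -> R) :
  kummer_sol mu c l f f1 f2 -> kummer_sol mu c l g g1 g2 ->
  let W x := x `^ mu * expR (l * x) * (f x * g1 x - f1 x * g x) in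
  forall x y : R, 0 < x -> x < y -> W y = W x.
Proof.
move=> [C2f fop] [C2g gop] W x y x0 xy.
have dl (z : R) : is_derive z 1 (fun t => l * t) l.
  by apply: is_derive_eq (is_derive_scalef l (is_derive_id z 1)) _; rewrite mulr1.
have dW (z : R) : 0 < z -> is_derive z 1 W 0.
  move=> z0; have [df df1 _] := C2f z z0; have [dg dg1 _] := C2g z z0.
  have de := is_derive1_comp (is_derive_expR (l * z)) (dl z).
  have d := is_derive_mulf (is_derive_mulf (is_derive1_powR mu z0) de)
    (is_derive_addf (is_derive_mulf df dg1) (is_derive_scalef (-1) (is_derive_mulf df1 dg))).
  have -> : W = (fun t => t `^ mu * (expR \o *%R l) t *
      (f t * g1 t + -1 * (f1 t * g t))).
    by apply/funext => t; rewrite /W /= mulN1r.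
  apply: is_derive_eq d _; rewrite /= (powR_succ mu z0).
  have := fop z z0; have := gop z z0; rewrite /kummer_op => Hg Hf.
  transitivity (z `^ (mu - 1) * expR (l * z) *
    (f z * (z * g2 z + (l * z + mu) * g1 z + l * c * g z)
     - g z * (z * f2 z + (l * z + mu) * f1 z + l * c * f z))); first by ring.
  by rewrite Hf Hg; ring.
have c0 (z : R) : 0 < z -> {for z, continuous (cst 0 : R -> R)}.
  by move=> _; exact: cvg_cst.
have := Rintegral_FTC x0 xy dW c0.
by rewrite Rintegral_segment_cst ?ltW// mul0r => /esym/eqP; rewrite subr_eq0 => /eqP.
Qed.

(** The square of the constant Wronskian is at most a constant times x F(x) x^(mu + 2 nu) near 0,
    with F the integrable function of the hypothesis. As x F(x) takes arbitrarily small values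
    there, the Wronskian is 0 and the solutions are proportional. *)
Lemma regular_sol_unique (f f1 f2 g g1 g2 : R -> R) :
  kummer_sol mu c l f f1 f2 -> regular_sol mu c l g g1 g2 ->
  integrable_on Rpos (fun x => x `^ (mu - 1) * (f1 x ^+ 2 + f x ^+ 2)) ->
  exists C, forall x : R, 0 < x -> f x = C * g x.
Proof.
move=> solf [solg [nu [C [munu C0 gC]]] [z z0 gz]] iF.
pose W x := x `^ mu * expR (l * x) * (f x * g1 x - f1 x * g x).
have WE x y : 0 < x -> 0 < y -> W x = W y.
  move=> x0 y0; have [xy|yx|-> //] := ltgtP x y.
    exact/esym/(wronskian_cst solf solg).
  exact: (wronskian_cst solf solg).
have Wz : W z = 0.
  apply/eqP; rewrite -sqrf_eq0 eq_le sqr_ge0 andbT leNgt; apply/negP => Wpos.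
  (* Bounds 4 C^2 exp(2 l x) on (0, 1); the added 1 keeps it positive. *)
  pose M := 4 * C ^+ 2 * expR (2 * `|l|) + 1.
  have M0 : 0 < M by rewrite ltr_wpDl// !mulr_ge0 ?expR_ge0 ?sqr_ge0.
  have [x /andP[x0 x1]] := integrable_small_left iF ltr01 (divr_gt0 Wpos M0).
  rewrite ltr_pdivlMr// ltNge => /negP; apply.
  rewrite (WE z x)// /W; have [gx g1x] := gC x x0 x1.
  set F := x `^ (mu - 1) * (f1 x ^+ 2 + f x ^+ 2).
  have F0 : 0 <= F by rewrite mulr_ge0 ?powR_ge0// addr_ge0 ?sqr_ge0.
  have D : (f x * g1 x - f1 x * g x) ^+ 2 <= 4 * C ^+ 2 * (x `^ nu) ^+ 2 * (f1 x ^+ 2 + f x ^+ 2).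
    have sq (s : R) : `|s| <= C * x `^ nu -> s ^+ 2 <= C ^+ 2 * (x `^ nu) ^+ 2.
      move=> sC; rewrite -exprMn -[s ^+ 2]real_normK ?num_real//.
      by rewrite lerXn2r// nnegrE mulr_ge0 ?powR_ge0.
    have := sq _ gx; have := sq _ g1x; set T := C ^+ 2 * _ => G1 G.
    have T0 : 0 <= T by rewrite mulr_ge0 ?sqr_ge0.
    have P1 : (f x * g1 x) ^+ 2 <= f x ^+ 2 * T by rewrite exprMn ler_wpM2l ?sqr_ge0.
    have P2 : (f1 x * g x) ^+ 2 <= f1 x ^+ 2 * T by rewrite exprMn ler_wpM2l ?sqr_ge0.
    have -> : 4 * C ^+ 2 * (x `^ nu) ^+ 2 * (f1 x ^+ 2 + f x ^+ 2) =
      4 * (f x ^+ 2 * T) + 4 * (f1 x ^+ 2 * T) by rewrite /T; ring.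
    have := sqr_ge0 (f x * g1 x + f1 x * g x).
    have := sqr_ge0 (f x * g1 x); have := sqr_ge0 (f1 x * g x); nra.
  have Ex : expR (l * x) ^+ 2 <= expR (2 * `|l|).
    rewrite -expRM_natl mulr_natl ler_expR.
    have : l * x <= `|l|.
      apply: le_trans (ler_norm _) _; rewrite normrM (gtr0_norm x0) ler_piMr// ltW//.
    by rewrite mulr2n; lra.
  rewrite !exprMn; apply: le_trans (ler_wpM2l _ D) _.
    by rewrite mulr_ge0 ?sqr_ge0.
  have -> : (x `^ mu) ^+ 2 * expR (l * x) ^+ 2 *
     (4 * C ^+ 2 * (x `^ nu) ^+ 2 * (f1 x ^+ 2 + f x ^+ 2)) =
     (x * F) * (4 * C ^+ 2 * expR (l * x) ^+ 2) * x `^ (mu + 2 * nu).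
    have -> : x `^ (mu + 2 * nu) = x `^ mu * (x `^ nu) ^+ 2.
      rewrite powRD ?(gt_eqF x0) ?implybT//; congr (_ * _).
      by rewrite mulrC -powR_mulrn ?powR_ge0// -powRrM.
    by rewrite /F (powR_succ mu x0); ring.
  rewrite (ger0_norm F0) -[leLHS]mulrA (ler_wpM2l (mulr_ge0 (ltW x0) F0))//.
  have xp : x `^ (mu + 2 * nu) <= 1.
    by rewrite -[leRHS](powRr0 x); apply: ger_powR; [rewrite x0 (ltW x1)|exact: ltW].
  apply: (@le_trans _ _ (4 * C ^+ 2 * expR (l * x) ^+ 2)).
    by rewrite ler_piMr// !mulr_ge0 ?sqr_ge0.
  by rewrite /M ler_wpDr// ler_wpM2l// mulr_ge0 ?sqr_ge0.
have [C2f fop] := solf; have [C2g gop] := solg.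
(* With this factor k, f - k g vanishes at z, and so does its derivative because the Wronskian is
   0. *)
exists (f z / g z) => x x0; set k := f z / g z.
apply/eqP; rewrite -subr_eq0; apply/eqP.
apply: (@kummer_sol_unique R mu c l (fun y => f y - k * g y) (fun y => f1 y - k * g1 y)
  (fun y => f2 y - k * g2 y) z) => //.
- split.
    move=> y y0; have [df df1 cf2] := C2f y y0; have [dg dg1 cg2] := C2g y y0.
    split.
    + have := is_derive_addf df (is_derive_scalef (- k) dg).
      by under eq_fun do rewrite mulNr; rewrite mulNr.
    + have := is_derive_addf df1 (is_derive_scalef (- k) dg1).
      by under eq_fun do rewrite mulNr; rewrite mulNr.
    + by apply: cvgB => //; apply: cvgM => //; exact: cvg_cst.
  move=> y y0; have := fop y y0; have := gop y y0; rewrite /kummer_op => Hg Hf.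
  transitivity ((y * f2 y + (l * y + mu) * f1 y + l * c * f y)
    - k * (y * g2 y + (l * y + mu) * g1 y + l * c * g y)); first by ring.
  by rewrite Hf Hg; ring.
- by rewrite /k divfK// subrr.
- move: Wz; rewrite /W => /eqP; rewrite !mulf_eq0 gt_eqF ?powR_gt0// gt_eqF ?expR_gt0//=.
  rewrite subr_eq0 => /eqP H.
  apply: (mulIf gz); rewrite mul0r mulrBl /k mulrAC divfK// H; ring.
Qed.

End wronskian.

(** * The equality case *)

(** A root of a nonnegative polynomial is critical: with a nonzero slope, a small step would reach a
    negative value. *)
Lemma ge0_quadratic_root {R : realType} (A B E l : R) :
  (forall t : R, 0 <= A + t ^+ 2 * B - t * E) -> A + l ^+ 2 * B - l * E = 0 ->
  A * B = 1 / 4 * E ^+ 2.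
Proof.
move=> q0 ql; have [d0|d0] := eqVneq (2 * l * B - E) 0.
  have EE : E = 2 * l * B by lra.
  have AE : A = l ^+ 2 * B by move: ql; rewrite EE; lra.
  by rewrite AE EE; field.
have N0 : 0 < `|B| + 1 by rewrite ltr_wpDl.
(* The denominator [|B| + 1] makes the change negative whatever the sign of [B]. *)
pose d := 2 * l * B - E; pose t := - d / (`|B| + 1).
have := q0 (l + t); rewrite leNgt => /negP[].
have -> : A + (l + t) ^+ 2 * B - (l + t) * E = (A + l ^+ 2 * B - l * E) + t * (d + t * B).
  by rewrite /d; ring.
have -> : t * (d + t * B) = - (d ^+ 2 / (`|B| + 1) ^+ 2 * (`|B| + 1 - B)).
  by rewrite /t; field; exact: lt0r_neq0.
have dd : 0 < d ^+ 2 by rewrite exprn_even_gt0.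
have ND : 0 < (`|B| + 1) ^+ 2 by rewrite exprn_gt0.
rewrite ql add0r oppr_lt0; apply: mulr_gt0; first exact: divr_gt0.
by have := ler_norm B; lra.
Qed.

(** A >= 0 (the value at 0) and A B > 0 give B > 0, and the double root is E / (2 B). *)
Lemma ge0_quadratic_minimizer {R : realType} (A B E : R) :
  (forall t : R, 0 <= A + t ^+ 2 * B - t * E) -> 0 < E -> A * B = 1 / 4 * E ^+ 2 ->
  exists2 l, 0 < l & A + l ^+ 2 * B - l * E = 0.
Proof.
move=> q0 E0 AB; have A0 : 0 <= A by have := q0 0; rewrite expr0n /= !mul0r subr0 addr0.
have AB0 : 0 < A * B by rewrite AB mulr_gt0 ?exprn_gt0// divr_gt0.
have B0 : 0 < B by have := AB0; nra.
exists (E / (2 * B)); first by rewrite divr_gt0// mulr_gt0.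
have -> : A = A * B / B by rewrite mulfK// gt_eqF.
by rewrite AB; field; exact: lt0r_neq0.
Qed.

(** x times k x^(mu-1) stays at least k near 0 if mu < 0, near +oo if mu > 0, while an integrable
    [F] makes x |F(x)| small somewhere there. *)
Lemma powR_weight_not_integrable {R : realType} (mu k : R) (F : R -> R) : mu != 0 ->
  integrable_on Rpos F -> 0 < k ->
  ~ (forall x : R, 0 < x -> k * x `^ (mu - 1) <= F x).
Proof.
move=> mu0 iF k0 HF.
have xF (x : R) : 0 < x -> 1 <= x `^ mu -> k <= x * `|F x|.
  move=> x0 xmu; apply: (@le_trans _ _ (k * x `^ mu)); first by rewrite ler_pMr.
  rewrite (powR_succ mu x0) mulrA mulrC ler_pM2l// (le_trans (HF x x0))// ler_norm//.
move: mu0; rewrite neq_lt => /orP[mu0|mu0].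
  have [x /andP[x0 x1]] := integrable_small_left iF ltr01 k0.
  rewrite ltNge => /negP; apply; apply: xF => //.
  by rewrite -[leLHS](powRr0 x); apply: ger_powR; [rewrite x0 ltW|exact: ltW].
have [x x1] := integrable_small_right 1 iF k0.
rewrite ltNge => /negP; apply; apply: xF; first exact: lt_trans x1.
by rewrite -[leLHS](powRr0 x); apply: ler_powR; exact: ltW.
Qed.

Theorem corollary3 (R : realType) (mu eps : R)
  (mu_neq0 : mu != 0) (eps_le : eps <= mu ^+ 2 / 4)
  (f f2 : R -> R) (hf : Ecompletion mu f f2) :
  let b := (mu - Num.sqrt (mu ^+ 2 - 4 * eps)) / 2 in
  (\int[lebesgue_measure]_(x in Rpos) (f2 x ^+ 2 * x `^ (mu + 1)))
  * (\int[lebesgue_measure]_(x in Rpos)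
       ((x ^+ 2 * f^`()%classic x ^+ 2 - eps * f x ^+ 2) * x `^ (mu - 1)))
  = 1 / 4 * (Num.sqrt (mu ^+ 2 - 4 * eps) + 1) ^+ 2
    * (\int[lebesgue_measure]_(x in Rpos) (f^`()%classic x ^+ 2 * x `^ mu)) ^+ 2
  <->
  exists C lambda : R, 0 < lambda /\
    (0 < mu -> forall x : R, 0 < x ->
       f x = C * expR (- (lambda * x)) * kummer b mu (lambda * x)) /\
    (mu < 0 -> forall x : R, 0 < x ->
       f x = C * (lambda * x) `^ (1 - mu) * expR (- (lambda * x))
             * kummer (b + 1 - mu) (2 - mu) (lambda * x)).
Proof.
move=> b; set s := Num.sqrt _ in b *; pose c := (mu + s) / 2.
have s0 : 0 <= s by exact: sqrtr_ge0.
have s2 : s ^+ 2 = mu ^+ 2 - 4 * eps by rewrite sqr_sqrtr//; lra.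
have epsE : c * (mu - c) = eps.
  have -> : c * (mu - c) = (mu ^+ 2 - s ^+ 2) / 4 by rewrite /c; field.
  by rewrite s2; field.
have bE : mu - c = b by rewrite /b /c; field.
have sE : 2 * c - mu + 1 = s + 1 by rewrite /c; field.
have cl := Ecompletion_energy_closure hf.
have [C1f _ _] := hf.
set f1 := f^`()%classic in cl C1f *.
have [[mf mf1 mf2] _ _] := cl.
have df (x : R) : 0 < x -> is_derive x 1 f (f1 x).
  move=> x0; have /C1f[dfx _] : Rpos x by rewrite RposE.
  by apply: DeriveDef => //; rewrite /f1 derive1E.
have cf1 (x : R) : 0 < x -> {for x, continuous f1}.
  by move=> x0; have /C1f[] : Rpos x by rewrite RposE.
have prim := energy_closure_primitive cl cf1.
pose F l x := x `^ (mu - 1) * kummer_op mu c l f f1 f2 x ^+ 2.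
have F0 l x : 0 <= F l x by rewrite mulr_ge0 ?powR_ge0 ?sqr_ge0.
set A := \int[leb]_(x in Rpos) (f2 x ^+ 2 * x `^ (mu + 1)).
set B := \int[leb]_(x in Rpos) ((x ^+ 2 * f1 x ^+ 2 - eps * f x ^+ 2) * x `^ (mu - 1)).
set D := \int[leb]_(x in Rpos) (f1 x ^+ 2 * x `^ mu).
have qE l : integrable_on Rpos (F l) /\
    \int[leb]_(x in Rpos) F l x = A + l ^+ 2 * B - l * ((s + 1) * D).
  have [iF FE] := quadratic_identity c cl l; split => //.
  by rewrite FE epsE sE /A /B /D; ring.
have q0 l : 0 <= A + l ^+ 2 * B - l * ((s + 1) * D).
  by rewrite -(qE l).2; apply: Rintegral_ge0.
(* The equality now reads A B = E^2 / 4 for E = (s + 1) D: the discriminant vanishes. *)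
have -> : 1 / 4 * (s + 1) ^+ 2 * D ^+ 2 = 1 / 4 * ((s + 1) * D) ^+ 2 by ring.
have D0 : 0 <= D by apply: Rintegral_ge0 => x _; rewrite mulr_ge0 ?sqr_ge0 ?powR_ge0.
have iff1 := integrable_f_sqr cl.
have sol l : 0 < l -> exists g g1 g2, regular_sol mu c l g g1 g2 /\
    (0 < mu -> forall x : R, 0 < x -> g x = expR (- (l * x)) * kummer b mu (l * x)) /\
    (mu < 0 -> forall x : R, 0 < x -> g x = (l * x) `^ (1 - mu) *
       (expR (- (l * x)) * kummer (b + 1 - mu) (2 - mu) (l * x))).
  move=> l0; move: mu_neq0; rewrite neq_lt => /orP[mu0|mu0].
    have [g1 [g2 Hg]] := regular_sol_neg c mu0 l0.
    do 3 eexists; split; [exact: Hg|split=> [|_ x x0]; first by rewrite ltNge ltW].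
    rewrite /kummer_decay; do 2 congr (_ * _); congr (kummer _ _ _).
    by rewrite -bE; ring.
  do 3 eexists; split; [exact: (regular_sol_pos c l mu0)|split=> [_ x x0|]].
    by rewrite /kummer_decay bE.
  by rewrite ltNge ltW.
split=> [AB|[C [l [l0 [fpos fneg]]]]].
  have [Dz|Dpos] := eqVneq D 0.
    have f1z : {ae leb, forall x : R, 0 < x -> f1 x = 0}.
      have pos (x : R) : 0 < x -> 0 <= f1 x ^+ 2 * x `^ mu.
        by rewrite mulr_ge0 ?sqr_ge0 ?powR_ge0.
      have := Rintegral_eq0_ae (integrable_f1_sqr cl) pos Dz.
      apply: filterS; first exact: (ae_filter_ringOfSetsType leb).
      move=> x Hx x0; have /eqP := Hx x0.
      by rewrite mulf_eq0 sqrf_eq0 [x `^ mu == 0]gt_eqF ?powR_gt0// orbF => /eqP.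
    have fcst (x y : R) : 0 < x -> x < y -> f y = f x.
      move=> x0 xy; apply/eqP; rewrite -subr_eq0 -(Rintegral_FTC x0 xy df cf1).
      rewrite (@ae_eq_Rintegral_Rpos R _ f1 (cst 0))//.
      - by rewrite Rintegral_segment_cst ?mul0r// ltW.
      - exact: segment_Rpos.
    have f0 (x : R) : 0 < x -> f x = 0.
      move=> x0; apply/eqP; rewrite -sqrf_eq0 eq_le sqr_ge0 andbT leNgt; apply/negP => fx.
      apply: (powR_weight_not_integrable mu_neq0 iff1 fx) => y y0.
      have -> : f x = f y by have [/fcst->|/fcst->|->] := ltgtP x y.
      by rewrite mulrC ler_wpM2l ?powR_ge0// lerDr sqr_ge0.
    (* The zero function: C = 0, with an arbitrary positive lambda. *)
    exists 0, 1; split=> //; split=> _ x /f0 ->; by rewrite !mul0r.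
  have Epos : 0 < (s + 1) * D.
    by rewrite mulr_gt0 ?ltr_wpDl// lt_neqAle eq_sym Dpos.
  have [l l0 ql] := ge0_quadratic_minimizer q0 Epos AB.
  have [iF FE] := qE l; rewrite ql in FE.
  have Fz := Rintegral_eq0_ae iF (fun x _ => F0 l x) FE.
  (* The continuous value that L f = 0 prescribes for f''. *)
  pose phi x := - ((l * x + mu) * f1 x + l * c * f x) / x.
  have cphi (x : R) : 0 < x -> {for x, continuous phi}.
    move=> x0; apply: cvgM; last by apply: cvgV; [rewrite gt_eqF|exact: cvg_id].
    apply: cvgN; apply: cvgD.
      apply: cvgM; last exact: cf1.
      exact: is_derive_continuous (is_derive_affine l mu x).
    by apply: cvgM; [exact: cvg_cst|exact: is_derive_continuous (df x x0)].
  have f2phi : {ae leb, forall x : R, 0 < x -> f2 x = phi x}.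
    apply: filterS Fz; first exact: (ae_filter_ringOfSetsType leb).
    move=> x Hx x0; have /eqP := Hx x0.
    rewrite /F mulf_eq0 sqrf_eq0 gt_eqF ?powR_gt0//= => /eqP H.
    apply: (mulfI (lt0r_neq0 x0)); apply/eqP; rewrite -subr_eq0; apply/eqP.
    by rewrite -[RHS]H /phi /kummer_op; field; exact: lt0r_neq0.
  have dphi := @continuous_primitive_derive R f1 phi cphi.
  (* f' is a primitive of [f2], hence of [phi], so f is a classical solution. *)
  have solf : kummer_sol mu c l f f1 phi.
    split=> x x0.
      split; [exact: df| |exact: cphi].
      apply: dphi => // a b' a0 ab; rewrite (prim a b' a0 ab).2.
      apply: ae_eq_Rintegral_Rpos => //; first exact: segment_Rpos.
      exact: measurable_Rpos_continuous.
    by rewrite /kummer_op /phi; field; exact: lt0r_neq0.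
  have [g [g1 [g2 [Hg [gpos gneg]]]]] := sol l l0.
  have [C HC] := regular_sol_unique solf Hg iff1.
  exists C, l; split=> //; split=> mu0 x x0; rewrite HC//.
    by rewrite gpos// mulrA.
  by rewrite gneg// !mulrA.
(* Converse: f is a multiple of the regular solution g, and the aim is that l is a root of the
   quadratic polynomial. *)
have [g [g1 [g2 [[[C2g gop] _ _] [gpos gneg]]]]] := sol l l0.
have fg (x : R) : 0 < x -> f x = C * g x.
  move=> x0; move: (mu_neq0); rewrite neq_lt => /orP[mu0|mu0].
    by rewrite fneg// gneg// !mulrA.
  by rewrite fpos// gpos// mulrA.
have f1g (x : R) : 0 < x -> f1 x = C * g1 x.
  move=> x0; have [dg _ _] := C2g x x0.
  have : is_derive x 1 f (C * g1 x).
    apply: near_eq_is_derive (is_derive_scalef C dg); near=> y.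
    by rewrite fg//; near: y; exact: lt_nbhsr.
  by move=> [_ <-]; rewrite /f1 derive1E.
have df1 (x : R) : 0 < x -> is_derive x 1 f1 (C * g2 x).
  move=> x0; have [_ dg1 _] := C2g x x0.
  apply: near_eq_is_derive (is_derive_scalef C dg1); near=> y.
  by rewrite f1g//; near: y; exact: lt_nbhsr.
have cphi (x : R) : 0 < x -> {for x, continuous (fun y => C * g2 y)}.
  by move=> x0; have [_ _ cg2] := C2g x x0; apply: cvgM => //; exact: cvg_cst.
(* [f2] and C g'' both have f' as a primitive, so they agree almost everywhere. *)
have f2g : {ae leb, forall x : R, 0 < x -> f2 x - C * g2 x = 0}.
  apply: Rintegral_segments_eq0_ae => x y x0 xy.
  have [if2 f2E] := prim x y x0 xy.
  have iphi : integrable_on `[x, y] (fun y => C * g2 y) by exact: integrable_segment.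
  split; first exact: integrable_on_sub.
  by rewrite Rintegral_sub// -f2E (Rintegral_FTC x0 xy df1 cphi) subrr.
have Fz : \int[leb]_(x in Rpos) F l x = 0.
  have /integrableP[/measurable_EFinP mF _] := (qE l).1.
  rewrite (@ae_eq_Rintegral_Rpos R Rpos (F l) (cst 0))//.
    by rewrite /Rintegral integral0.
  apply: filterS f2g; first exact: (ae_filter_ringOfSetsType leb).
  move=> x Hx x0; rewrite /F.
  suff -> : kummer_op mu c l f f1 f2 x = 0 by rewrite expr0n mulr0.
  rewrite /kummer_op fg// f1g//.
  transitivity (x * (f2 x - C * g2 x) + C * kummer_op mu c l g g1 g2 x).
    by rewrite /kummer_op; ring.
  by rewrite (Hx x0) gop// !mulr0 addr0.
by apply: (ge0_quadratic_root q0 (l := l)); rewrite -(qE l).2.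
Unshelve. all: by end_near. Qed.
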